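(* Let $f:\mathbb{N}\to\mathbb{C}$ be an arithmetic function for which there exist a subset $Q$ of the set of primes and a subset $S\subseteq\mathbb{N}$ with $1\in S$ such that: (i) $(\mu*f)(n)=0$ for every $n$ not of the form $p^\nu$ with $p\in Q$, $\nu\in S$; (ii) $(\mu*f)(p^\nu)=g(p)$ depends only on $p$, for all $p\in Q$, $\nu\in S$; (iii) $g(p)\ll (\log p)^\eta$ as $p\to\infty$, for some fixed real $\eta\ge 0$. Then \[ \sum_{\substack{m,n\in\mathbb{N}\\ mn\le x}} f(\gcd(m,n)) = x(C_f\log x + D_f) + O\!\left(x^{1/2}(\log x)^\eta\right), \] where \[ C_f=\sum_{p\in Q} g(p)\sum_{\nu\in S}\frac{1}{p^{2\nu}},\qquad D_f=(2\gamma-1)C_f - 2\sum_{p\in Q} g(p)\log p\sum_{\nu\in S}\frac{\nu}{p^{2\nu}}. \]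
   Context: $\mu$ is the Möbius function and $*$ is Dirichlet convolution, $(\mu*f)(n)=\sum_{d\mid n}\mu(d)f(n/d)$. $\gamma$ is Euler's constant. The sum is over ordered pairs of positive integers $(m,n)$ with $mn\le x$. *)

(* Defs.v *)
From HB Require Import structures.
From mathcomp Require Import all_boot all_order all_algebra.
From mathcomp Require Import all_classical all_reals all_analysis.
From mathcomp Require Import complex.

Set Implicit Arguments.
Unset Strict Implicit.
Unset Printing Implicit Defensive.

Import Order.TTheory GRing.Theory Num.Theory.
Import numFieldNormedType.Exports.

Local Open Scope classical_set_scope.
Local Open Scope ring_scope.
Local Open Scope complex_scope.

Definition mobius (n : nat) : int :=
  if (0 < n)%N && all (fun p => logn p n == 1%N) (primes n)
  then (-1) ^+ size (primes n) else 0.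

Definition dirichlet_conv (K : nzRingType) (a b : nat -> K) (n : nat) : K :=
  \sum_(d <- divisors n) a d * b (n %/ d)%N.

(* [series harmonic n] is [1 + 1/2 + ... + 1/n]. *)
Definition euler_gamma (R : realType) : R :=
  limn (fun n : nat => series (@harmonic R) n - ln n%:R).

(* [m * n <= x] with [m, n >= 1] forces both [m] and [n] to be at most the
   integer part of [x]. *)
Definition gcd_sum (R : realType) (f : nat -> R[i]) (x : R) : R[i] :=
  \sum_(1 <= m < (Num.truncn x).+1)
    \sum_(1 <= n < (Num.truncn x).+1 | (m * n)%:R <= x) f (gcdn m n).

(* The infinite sums are limits of partial sums taken in increasing order of
   the index; [R[i]^o] carries the topology of the complex modulus. *)
Definition const_C (R : realType) (Q S : set nat) (g : nat -> R[i]) : R[i] :=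
  \big[+%R/0]_(0 <= p <oo | p \in Q)
    (g p * (\big[+%R/0]_(0 <= nu <oo | nu \in S)
              ((p%:R ^+ (2 * nu))^-1 : R))%:C : R[i]^o).

Definition const_D (R : realType) (Q S : set nat) (g : nat -> R[i]) : R[i] :=
  (2 * euler_gamma R - 1)%:C * const_C Q S g -
  2 * (\big[+%R/0]_(0 <= p <oo | p \in Q)
    (g p * (ln (p%:R : R))%:C *
       (\big[+%R/0]_(0 <= nu <oo | nu \in S)
          (nu%:R / p%:R ^+ (2 * nu) : R))%:C : R[i]^o)).

(* Main.v *)
(* Write h = mu * f and Delta(y) = sum_(n <= y) tau(n) - (y log y + (2 gamma - 1) y).
   Moebius inversion turns the sum into sum_d h(d) D(x / d^2), with D the divisor
   summatory function, and only d = p^nu with p in Q and nu in S contribute; the main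
   terms add up to x (C_f log x + D_f), and Delta(x / d^2) is left.  Dirichlet's bound
   Delta(y) << y^(1/2) would lose a factor log log x in the sum over d <= x^(1/2);
   any bound Delta(y) << y^theta with theta < 1/2 suffices, because the sum of
   (x / p^2)^theta over p <= x^(1/2) is then O(x^(1/2)).  An elementary argument
   gives theta = 19/40.  By the hyperbola method Delta(y) is, up to O(1), the sum of the
   sawtooth of y / n over n <= y^(1/2).  Near n the function y / n is almost linear;
   if its slope is close to a / q with a and q coprime, then over q consecutive values
   of n the fractional parts are almost equidistributed and the sawtooth sums to O(1).
   Slopes with a small denominator q are rare. *)

Require Import Defs.
From HB Require Import structures.
From mathcomp Require Import all_boot all_order all_algebra.
From mathcomp Require Import all_classical all_reals all_analysis.
From mathcomp Require Import complex.
From mathcomp Require Import zify ring lra.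

Set Implicit Arguments.
Unset Strict Implicit.
Unset Printing Implicit Defensive.

Import Order.TTheory GRing.Theory Num.Theory.
Import numFieldNormedType.Exports.

Local Open Scope classical_set_scope.
Local Open Scope ring_scope.
Local Open Scope complex_scope.

(** * Sawtooth sums along a hyperbola *)

(** The exponent is 19/40 = 1/2 - 1/40: with s about M^(1/2) and k about s^(1/20), the sawtooth sum
    over n <= s is bounded by O(s/k), a saving of M^(1/40) over the trivial bound. The constants C_f
    and D_f are complete series, so the remainder contains Delta(x / d^2) also for d^2 > x. There D
    vanishes and Delta(y) is minus the main term, of size y |log y|. One envelope, [decay], bounds
    Delta in both ranges, so head and tail need no separate main-term estimates. Summation over p is
    then majorized by summation over all integers n; in the tail a further n^(1/4) is spent on the
    powers of log n, which exceed those of log x. *)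

Lemma sum_modn_coprime (q a z : nat) : (0 < q)%N -> coprime a q ->
  (\sum_(j < q) (z + j * a) %% q = \sum_(j < q) j)%N.
Proof.
move=> q0 caq.
pose h (j : 'I_q) : 'I_q := Ordinal (ltn_pmod (z + j * a) q0).
have hinj : injective h.
  move=> i j /(congr1 val) /= /eqP; rewrite eqn_modDl => eij.
  apply: val_inj => /=.
  wlog le_ij : i j eij / (i <= j)%N.
    by move=> W; case: (leqP i j) => [/W|/ltnW /W W']; [exact|rewrite W' // eq_sym].
  move: eij; rewrite eq_sym eqn_mod_dvd ?leq_mul2r ?le_ij ?orbT// -mulnBl.
  rewrite Gauss_dvdl 1?coprime_sym//.
  have [/eqP|pos] := posnP (j - i); first by rewrite subn_eq0 => ? _; lia.
  by move/dvdn_leq => /(_ pos); have := ltn_ord j; lia.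
rewrite [RHS](reindex_inj hinj) /=.
by apply: eq_bigr.
Qed.

(** Centred to have mean zero over a period; [Num.truncn] is the floor for [x >= 0], the only range
    used. *)
Definition saw (R : archiRealFieldType) (x : R) : R :=
  x - (Num.truncn x)%:R - 2^-1.

Lemma norm_saw_le1 (R : archiRealFieldType) (x : R) : 0 <= x -> `|saw x| <= 1.
Proof.
move=> /truncn_itv/andP[h1]; rewrite -natr1 => h2.
by rewrite /saw ler_norml; apply/andP; split; lra.
Qed.

Lemma sum_natr_ord (R : realFieldType) (q : nat) :
  \sum_(j < q) (j%:R : R) = q%:R * (q%:R - 1) / 2.
Proof.
elim: q => [|q IH]; first by rewrite big_ord0 !mul0r.
by rewrite big_ord_recr /= IH -natr1; field.
Qed.

(** The floor of [v j] lies between those of (z + j a) / q and (z + c + j a) / q, and both floor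
    sums are known exactly because the remainders modulo [q] permute 0, ..., q - 1. The window costs
    [c]; the remainders add up to q (q - 1) / 2, and (q - 1) / 2 misses the q / 2 removed by
    centring by 1/2. *)
Lemma norm_sum_saw_block (R : archiRealFieldType) (q a z c : nat) (v : nat -> R) :
  (0 < q)%N -> coprime a q ->
  (forall j, (j < q)%N ->
    (z + j * a)%:R <= q%:R * v j <= (z + c + j * a)%:R) ->
  `|\sum_(j < q) saw (v j)| <= c%:R + 1.
Proof.
move=> q0 caq hv.
have q0R : (0 : R) < q%:R by rewrite ltr0n.
have divsum (e : nat) : q%:R * (\sum_(j < q) ((e + j * a) %/ q)%:R : R)
    = \sum_(j < q) (e + j * a)%:R - q%:R * (q%:R - 1) / 2.
  rewrite -sum_natr_ord -!natr_sum -(sum_modn_coprime e q0 caq).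
  rewrite -natrM; apply/eqP; rewrite eq_sym subr_eq -natrD eqr_nat big_distrr.
  rewrite /= -big_split /=; apply/eqP/eq_bigr => j _.
  by rewrite [LHS](divn_eq _ q) mulnC.
have v0 j : (j < q)%N -> 0 <= v j.
  move=> /hv/andP[+ _]; move/(le_trans (ler0n _ _)).
  by rewrite pmulr_rge0.
have lo : (\sum_(j < q) ((z + j * a) %/ q)%:R : R)
    <= \sum_(j < q) (Num.truncn (v j))%:R.
  apply: ler_sum => j _; rewrite ler_nat truncn_ge_nat ?v0//.
  have /andP[h _] := hv _ (ltn_ord j).
  rewrite -(ler_pM2l q0R); apply: le_trans h.
  by rewrite -natrM ler_nat mulnC leq_divM.
have up : (\sum_(j < q) (Num.truncn (v j))%:R : R)
    <= \sum_(j < q) ((z + c + j * a) %/ q)%:R.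
  apply: ler_sum => j _; rewrite ler_nat leq_divRL//.
  have /andP[_ h] := hv _ (ltn_ord j).
  have /andP[h1 _] := truncn_itv (v0 _ (ltn_ord j)).
  rewrite -(ler_nat R); apply: le_trans h.
  by rewrite natrM mulrC ler_pM2l.
have vlo : (\sum_(j < q) (z + j * a)%:R : R) <= q%:R * \sum_(j < q) v j.
  by rewrite mulr_sumr; apply: ler_sum => j _; have /andP[] := hv _ (ltn_ord j).
have vup : q%:R * (\sum_(j < q) v j) <= (\sum_(j < q) (z + c + j * a)%:R : R).
  by rewrite mulr_sumr; apply: ler_sum => j _; have /andP[] := hv _ (ltn_ord j).
have shift : \sum_(j < q) (z + c + j * a)%:R
    = \sum_(j < q) (z + j * a)%:R + q%:R * c%:R :> R.
  under eq_bigr do rewrite addnAC natrD.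
  by rewrite big_split /= sumr_const card_ord mulr_natl.
have -> : \sum_(j < q) saw (v j) =
    \sum_(j < q) v j - \sum_(j < q) (Num.truncn (v j))%:R - q%:R / 2 :> R.
  rewrite /saw !sumrB sumr_const card_ord -mulr_natl; lra.
rewrite -(ler_pM2l q0R) divsum in lo.
rewrite -(ler_pM2l q0R) divsum shift in up.
rewrite shift in vup.
rewrite -(ler_pM2l q0R) -[X in X * `|_|](gtr0_norm q0R) -normrM ler_norml.
move: lo up vlo vup.
set V := \sum_(j < q) v j; set W := \sum_(j < q) _; set A := \sum_(j < q) _.
move: V W A => V W A lo up vlo vup.
rewrite !mulrBr; move: q0R lo up vlo vup.
move: (q%:R * V) (q%:R * W) => qV qW.
move: (q%:R : R) (c%:R : R) => r d r0 lo up vlo vup.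
by apply/andP; split; lra.
Qed.

(** Pigeonhole on the fractional parts of the multiples of [x]. *)
Lemma dirichlet_approx (R : archiRealFieldType) (x : R) (T : nat) :
  0 <= x -> (0 < T)%N ->
  exists a q : nat, [/\ (0 < q)%N, (q <= T)%N, coprime a q
    & `|q%:R * x - a%:R| * T%:R <= 1].
Proof.
move=> x0; case: T => // T _.
(* Dividing [a] and [q] by their gcd divides the error as well, so coprimality costs nothing. *)
suff [a [q [q0 qT h]]] : exists a q : nat, [/\ (0 < q)%N, (q <= T.+1)%N
    & `|q%:R * x - a%:R| * T.+1%:R <= 1].
  have g0 : (0 < gcdn a q)%N by rewrite gcdn_gt0 q0 orbT.
  exists (a %/ gcdn a q)%N, (q %/ gcdn a q)%N; split.
  - by rewrite divn_gt0// dvdn_leq// dvdn_gcdr.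
  - exact: leq_trans (leq_div _ _) qT.
  - by rewrite /coprime -(eqn_pmul2r g0) muln_gcdl !divnK ?dvdn_gcdl ?dvdn_gcdr// mul1n.
  apply: le_trans h; rewrite ler_wpM2r//.
  have -> : q%:R = (gcdn a q)%:R * (q %/ gcdn a q)%:R :> R.
    by rewrite -natrM mulnC divnK// dvdn_gcdr.
  have -> : a%:R = (gcdn a q)%:R * (a %/ gcdn a q)%:R :> R.
    by rewrite -natrM mulnC divnK// dvdn_gcdl.
  rewrite -mulrA -mulrBr normrM normr_nat ler_peMl//.
  by rewrite ler1n.
pose fr (j : nat) : R := j%:R * x - (Num.truncn (j%:R * x))%:R.
have fr01 j : 0 <= fr j < 1.
  have /truncn_itv/andP[h1] : 0 <= j%:R * x by rewrite mulr_ge0.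
  by rewrite -natr1 /fr => h2; apply/andP; split; lra.
have Tr0 : (0 : R) < T.+1%:R by rewrite ltr0n.
(* [T.+2] fractional parts fall into [T.+1] boxes of width 1 / [T.+1]. *)
pose F (j : 'I_T.+2) : 'I_T.+1 := inord (Num.truncn (T.+1%:R * fr j)).
have FE j : F j = Num.truncn (T.+1%:R * fr j) :> nat.
  rewrite /F inordK// truncn_lt_nat; have /andP[h1 h2] := fr01 j.
    by rewrite -[X in _ < X]mulr1 ltr_pM2l.
  by rewrite mulr_ge0.
have /injectivePn[i [j ij eF]] : ~~ injectiveb F.
  by apply/negP => /injectiveP/leq_card; rewrite !card_ord ltnn.
wlog lt_ij : i j ij eF / (i < j)%N.
  move=> W; case: (ltngtP i j) => [h|h|/val_inj h]; first exact: (W i j).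
    by apply: (W j i) => //; rewrite eq_sym.
  by rewrite h eqxx in ij.
have mono : (Num.truncn (i%:R * x) <= Num.truncn (j%:R * x))%N.
  by rewrite le_truncn// ler_wpM2r// ler_nat ltnW.
exists (Num.truncn (j%:R * x) - Num.truncn (i%:R * x))%N, (j - i)%N; split.
- by rewrite subn_gt0.
- by have := ltn_ord j; lia.
rewrite !natrB// ?(ltnW lt_ij)//.
have -> : (j%:R - i%:R) * x - ((Num.truncn (j%:R * x))%:R -
   (Num.truncn (i%:R * x))%:R) = fr j - fr i by rewrite /fr; ring.
have /(congr1 val) := eF; rewrite /= !FE => E.
have pos k : 0 <= T.+1%:R * fr k by rewrite mulr_ge0//; case/andP: (fr01 k).
have /andP[a1 a2] := truncn_itv (pos i).
rewrite E -[(Num.truncn _).+1%:R]natr1 in a1 a2.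
have /andP[b1 b2] := truncn_itv (pos j); rewrite -[(Num.truncn _).+1%:R]natr1 in b2.
rewrite -[X in _ * X](gtr0_norm Tr0) -normrM mulrC mulrBr ler_norml.
by apply/andP; split; lra.
Qed.

(** The block is read downwards from [n] so that the slope is positive: M/(n - j) = M/n + j M/n^2 +
    M j^2/(n^2 (n - j)) exactly. After multiplication by [q] the linear term is within 1 of [j * a],
    since j < q <= T, and the last term lies in [0, 1] by the two size conditions. *)
Lemma norm_sum_saw_div_block (R : archiRealFieldType) (M n q a T : nat) :
  (0 < q)%N -> (q <= T)%N -> coprime a q -> (n <= M)%N -> (2 * T <= n)%N ->
  (2 * M * T ^ 3 <= n ^ 3)%N ->
  `|q%:R * (M%:R / n%:R ^+ 2) - a%:R| * T%:R <= 1 :> R ->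
  `|\sum_(j < q) saw (M%:R / (n - j)%:R : R)| <= 5.
Proof.
move=> q0 qT caq nM Tn big app.
have T0 : (0 : R) < T%:R by rewrite ltr0n; lia.
have q0R : (0 : R) < q%:R by rewrite ltr0n.
have n0 : (0 < n)%N by lia.
have n0R : (0 : R) < n%:R by rewrite ltr0n.
set b := M%:R / n%:R : R.
have b0 : 0 <= q%:R * b by rewrite mulr_ge0 ?divr_ge0.
set z0 := Num.truncn (q%:R * b).
have /andP[z1 z2] := truncn_itv b0; rewrite -/z0 -[z0.+1%:R]natr1 in z1 z2.
have z0_gt0 : (0 < z0)%N.
  rewrite truncn_gt0 mulr_ege1// ?ler1n//.
  by rewrite /b ler_pdivlMr// mul1r ler_nat.
(* The window starts one lower to absorb a linear error of -1; [z0 > 0], which comes from [n <= M],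
   makes the predecessor a true subtraction. The width 4 consists of this shift, the fractional part
   of [q * b], the linear error and the quadratic term. *)
pose z := z0.-1.
have qe_nat j : (j < q)%N -> (q * (M * j ^ 2) <= n ^ 2 * (n - j))%N.
  move=> jq; have jT : (j <= T)%N by rewrite (leq_trans (ltnW jq)).
  have h1 : (q * (M * j ^ 2) <= T * (M * T ^ 2))%N.
    by rewrite leq_mul// leq_mul// leq_sqr.
  have h2 : (n ^ 3 <= 2 * (n ^ 2 * (n - j)))%N.
    rewrite [X in (X <= _)%N]expnSr mulnCA leq_mul2l; apply/orP; right.
    by move: jT Tn; clear; lia.
  have h3 : (2 * (T * (M * T ^ 2)) <= n ^ 3)%N.
    by apply: leq_trans big; rewrite (expnS T); clear; lia.
  by move: h1 h2 h3; clear; lia.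
clear big.
have -> : (5 : R) = 4%:R + 1 by lra.
apply: (@norm_sum_saw_block R q a z 4 (fun j => M%:R / (n - j)%:R)) => // j jq.
have nj0 : (0 : R) < (n - j)%:R by rewrite ltr0n; lia.
set al := M%:R / n%:R ^+ 2 in app *.
set e := M%:R * j%:R ^+ 2 / (n%:R ^+ 2 * (n - j)%:R) : R.
have njE : (n - j)%:R = n%:R - j%:R :> R by rewrite natrB//; lia.
have vE : M%:R / (n - j)%:R = b + j%:R * al + e.
  rewrite /b /al /e; rewrite njE in nj0 *.
  by field; rewrite !gt_eqF.
have e0 : 0 <= e by rewrite /e divr_ge0 ?mulr_ge0// ?exprn_ge0// ltW.
have e1 : q%:R * e <= 1.
  rewrite /e mulrA ler_pdivrMr ?mulr_gt0 ?exprn_gt0// mul1r.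
  by rewrite -!natrX -!natrM ler_nat qe_nat.
have d1 : `|q%:R * (j%:R * al) - (j * a)%:R| <= 1.
  have -> : q%:R * (j%:R * al) - (j * a)%:R = j%:R * (q%:R * al - a%:R).
    by rewrite natrM; ring.
  rewrite normrM normr_nat; apply: le_trans app; rewrite mulrC ler_wpM2l//.
  by rewrite ler_nat (leq_trans (ltnW jq)).
move: d1; rewrite vE ler_norml => /andP[d1 d2].
have qe0 : 0 <= q%:R * e by rewrite mulr_ge0// ltW.
rewrite !natrD.
have zE : z%:R = z0%:R - 1 :> R by rewrite /z -subn1 natrB.
rewrite zE !mulrDr; apply/andP; split; lra.
Qed.

(* A greedy descent from [s]: a step of length [q] from a good index, a step of
   length one from a bad one. *)
Lemma norm_sum_greedy (R : realFieldType) (F : nat -> R) (bad : pred nat)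
    (B : R) (L k T s : nat) :
  (0 < k)%N -> 0 <= B -> (forall n, `|F n| <= 1) ->
  (forall n, (L + T <= n)%N -> (n <= s)%N -> ~~ bad n ->
     exists q, [/\ (k <= q)%N, (q <= T)%N & `|\sum_(j < q) F (n - j)%N| <= B]) ->
  `|\sum_(L.+1 <= i < s.+1) F i| <=
    B / k%:R * (s - L)%:R + (\sum_(L.+1 <= i < s.+1) (bad i : nat))%:R + T%:R.
Proof.
move=> k0 B0 F1; have [m] := ubnP s; elim: m s => // m IH s sm good.
have k0R : (0 : R) < k%:R by rewrite ltr0n.
have Bk0 : 0 <= B / k%:R by rewrite divr_ge0// ltW.
have [sL|Ls] := leqP s L.
  rewrite !big_geq// normr0 addr_ge0// addr_ge0//.
  by rewrite mulr_ge0.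
have [sLT|LTs] := ltnP s (L + T).
  (* Close to [L] a block could overshoot; the fewer than [T] indices left are bounded trivially and
     account for the final [T%:R]. *)
  apply: (@le_trans _ _ (s - L)%:R).
    apply: le_trans (ler_norm_sum _ _ _) _.
    apply: le_trans (ler_sum _ (fun i _ => F1 i)) _.
    by rewrite sumr_const_nat.
  have h : (s - L)%:R <= T%:R :> R by rewrite ler_nat; lia.
  have h1 : 0 <= B / k%:R * (s - L)%:R by rewrite mulr_ge0.
  by apply: le_trans h _; rewrite lerDr addr_ge0.
case: (boolP (bad s)) => [bs|nbs].
  case: s sm good Ls LTs bs => // s sm good Ls LTs bs.
  rewrite (big_nat_recr s.+1)//= [X in _ + X%:R + _](big_nat_recr s.+1)//= bs natrD.
  have := IH s sm (fun n h1 h2 => good n h1 (leqW h2)).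
  have h : `|F s.+1| <= 1 by [].
  move=> IHs; apply: le_trans (ler_normD _ _) _.
  have h2 : B / k%:R * (s - L)%:R <= B / k%:R * (s.+1 - L)%:R.
    by rewrite ler_wpM2l// ler_nat leq_sub2r.
  rewrite -[true%:R]/(1 : R); lra.
have [q [kq qT hq]] := good s LTs (leqnn s) nbs.
have Lsq : (L <= s - q)%N by lia.
have split_at (V : nmodType) (G : nat -> V) : \sum_(L.+1 <= i < s.+1) G i =
    \sum_(L.+1 <= i < (s - q).+1) G i + \sum_(j < q) G (s - j)%N.
  rewrite (@big_cat_nat _ _ _ (s - q).+1)//=; last by lia.
  congr (_ + _); rewrite big_nat_rev /=.
  rewrite -{1}[(s - q).+1]add0n big_addn.
  have -> : (s.+1 - (s - q).+1 = q)%N by lia.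
  rewrite big_mkord; apply: eq_bigr => j _; congr G.
  by have := ltn_ord j; lia.
rewrite [X in `|X|]split_at [X in _ + X%:R + _]split_at natrD.
have := IH (s - q)%N.
have -> : (s - q < m)%N by lia.
move=> /(_ isT (fun n h1 h2 => good n h1 (leq_trans h2 (leq_subr _ _)))) IHs.
apply: le_trans (ler_normD _ _) _.
(* A block uses up at least [k] indices, so [B / k] per index pays for its bound [B]. *)
have h2 : B / k%:R * (s - q - L)%:R + B <= B / k%:R * (s - L)%:R.
  have -> : (s - L)%:R = (s - q - L)%:R + q%:R :> R by rewrite -natrD; congr _%:R; lia.
  rewrite mulrDr lerD2l mulrAC ler_pdivlMr// ler_wpM2l// ler_nat//.
have h3 : 0 <= (\sum_(j < q) bad (s - j))%N%:R :> R by [].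
lra.
Qed.

(** Induction lowers the top of the range to the largest marked index; the others lie at most [W]
    below it, hence in an interval of [W.+1] integers. *)
Lemma sum_pred_spread (P : pred nat) (L s W : nat) :
  (forall n n', (L < n)%N -> (n < n')%N -> (n' <= s)%N -> P n -> P n' ->
     (n' - n <= W)%N) ->
  (\sum_(L.+1 <= i < s.+1) (P i : nat) <= W.+1)%N.
Proof.
elim: s => [|s IH] spread; first by rewrite big_geq.
have [sL|Ls] := ltnP s L; first by rewrite big_geq//.
case: (boolP (P s.+1)) => [Ps|nPs]; last first.
  rewrite big_nat_recr//= (negbTE nPs) addn0; apply: IH => n n' h1 h2 h3.
  by apply: spread => //; lia.
have -> : (\sum_(L.+1 <= i < s.+2) (P i : nat) =
           \sum_(L.+1 <= i < s.+2 | P i) 1)%N.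
  by rewrite [RHS]big_mkcond; apply: eq_bigr => i _; case: (P i).
rewrite sum1_count -size_filter.
have <- : size (iota (s.+1 - W) W.+1) = W.+1 by rewrite size_iota.
apply: uniq_leq_size; first by rewrite filter_uniq// iota_uniq.
move=> i; rewrite mem_filter mem_index_iota mem_iota => /andP[Pi /andP[h1 h2]].
have [->|/eqP nis] := eqVneq i s.+1; first by apply/andP; split; lia.
by have := spread i s.+1 h1; (have -> : (i < s.+1)%N by lia) => /(_ isT (leqnn _) Pi Ps); lia.
Qed.

(* The blocks have lengths between [k] and [k ^ 5]; [k ^ 20 <= s] makes the
   curvature of [M / n] negligible on them, as long as [n > s %/ k]. *)
Lemma norm_sum_saw_divn (R : archiRealFieldType) (M s k : nat) :
  (0 < k)%N -> (s ^ 2 <= M)%N -> (M < s.+1 ^ 2)%N -> (k ^ 20 <= s)%N ->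
  `|\sum_(1 <= n < s.+1) saw (M%:R / n%:R : R)| <= 12 * s%:R / k%:R.
Proof.
move=> k0 sM Ms ks.
have saw1 (n : nat) : `|saw (M%:R / n%:R : R)| <= 1 by rewrite norm_saw_le1// divr_ge0.
have trivial_bound (m : nat) : `|\sum_(1 <= n < m.+1) saw (M%:R / n%:R : R)| <= m%:R.
  apply: le_trans (ler_norm_sum _ _ _) _.
  apply: le_trans (ler_sum _ (fun i _ => saw1 i)) _.
  by rewrite sumr_const_nat subn1.
have [k1|k2] := leqP k 1.
  have -> : k = 1%N by lia.
  apply: le_trans (trivial_bound s) _.
  have : (0 : R) <= s%:R by [].
  by lra.
have k0R : (0 : R) < k%:R by rewrite ltr0n.
(* About k^4 fractions a / q have q < k and a <= k^3, and each spoils at most about 2 s / T indices;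
   [T = k ^ 5] makes the total O(s / k). The indices up to [L], where the curvature may be large,
   number at most s / k. *)
pose T := (k ^ 5)%N; pose L := (s %/ k)%N.
have T0 : (0 < T)%N by rewrite expn_gt0 k0.
have T0R : (0 : R) < T%:R by rewrite ltr0n.
have s0 : (0 < s)%N by apply: leq_trans ks; rewrite expn_gt0 k0.
have Ls : (L <= s)%N by exact: leq_div.
pose P (q a n : nat) :=
  (0 < q)%N && (`|q%:R * (M%:R / n%:R ^+ 2) - a%:R| * T%:R <= 1 :> R).
(* The indices at which [dirichlet_approx] may return a block shorter than [k]. *)
pose bad n := [exists q : 'I_k, [exists a : 'I_(k ^ 3).+1, P q a n]].
have kle (i j : nat) : (i <= j)%N -> (k ^ i <= k ^ j)%N by move=> ?; rewrite leq_pexp2l.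
have two_kle (i j : nat) : (i < j)%N -> (2 * k ^ i <= k ^ j)%N.
  by move=> ij; apply: leq_trans (kle _ _ ij); rewrite expnS leq_mul2r k2 orbT.
have good n : (L + T <= n)%N -> (n <= s)%N -> ~~ bad n ->
    exists q, [/\ (k <= q)%N, (q <= T)%N &
      `|\sum_(j < q) saw (M%:R / (n - j)%N%:R : R)| <= 5].
  move=> LTn ns nbad.
  have n0 : (0 < n)%N by apply: leq_trans LTn; rewrite addn_gt0 T0 orbT.
  have n0R : (0 : R) < n%:R by rewrite ltr0n.
  have snk : (s < n * k)%N.
    by rewrite -ltn_divLR//; apply: leq_trans LTn; rewrite -addn1 leq_add2l.
  have Mnk : (M < (n * k) ^ 2)%N by apply: leq_trans Ms _; rewrite leq_sqr.
  have al0 : 0 <= M%:R / n%:R ^+ 2 :> R by rewrite divr_ge0// exprn_ge0// ltW.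
  (* Above [L] the slope is at most k^2, so q < k forces a <= k^3; this is the bound on numerators
     in [bad]. *)
  have al1 : M%:R / n%:R ^+ 2 <= k%:R ^+ 2 :> R.
    rewrite ler_pdivrMr ?exprn_gt0// -!natrX -natrM ler_nat mulnC -expnMn.
    exact: ltnW.
  have [a [q [q0 qT caq app]]] := dirichlet_approx al0 T0.
  exists q; split=> //.
    rewrite leqNgt; apply: contra nbad => qk; apply/existsP; exists (Ordinal qk).
    have ak : (a < (k ^ 3).+1)%N.
      rewrite ltnS -(ler_nat R).
      have h : `|q%:R * (M%:R / n%:R ^+ 2) - a%:R| <= 1 :> R.
        by apply: le_trans app; rewrite ler_peMr// ler1n.
      move: h; rewrite ler_norml => /andP[h _].
      have h2 : q%:R * (M%:R / n%:R ^+ 2) <= (k%:R - 1) * k%:R ^+ 2 :> R.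
        apply: ler_pM => //.
        by rewrite lerBrDr natr1 ler_nat.
      have h3 : 1 <= k%:R ^+ 2 :> R by rewrite -natrX ler1n expn_gt0 k0.
      rewrite natrX [_ ^+ 3]exprS; lra.
    by apply/existsP; exists (Ordinal ak); rewrite /P q0.
  have k19 : (k ^ 19 < n)%N.
    rewrite -(ltn_pmul2r k0) -expnSr; exact: leq_ltn_trans ks snk.
  apply: (@norm_sum_saw_div_block R M n q a T) => //.
  - by apply: leq_trans ns _; apply: leq_trans sM; rewrite -mulnn leq_pmulr.
  - by apply: leq_trans (ltnW k19); exact: two_kle.
  have h : (M * k ^ 20 <= (n * k) ^ 3)%N.
    by rewrite [X in (_ <= X)%N]expnSr leq_mul// ltnW// (leq_ltn_trans ks).
  (* The factor [k ^ 3] turns [n] into [n * k], which exceeds [s]; the condition becomes 2 M k^18 <=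
     (n k)^3. *)
  rewrite -(leq_pmul2r (_ : (0 < k ^ 3)%N)) ?expn_gt0 ?k0// -expnMn.
  have -> : (2 * M * T ^ 3 * k ^ 3 = M * (2 * k ^ 18))%N.
    by rewrite /T -expnM -mulnA -expnD mulnAC mulnC.
  by apply: leq_trans h; rewrite leq_mul2l two_kle ?orbT.
have spread q a n n' : (L < n)%N -> (n < n')%N -> (n' <= s)%N ->
    P q a n -> P q a n' -> (n' - n <= (2 * s) %/ T)%N.
  move=> Ln nn' n's /andP[q0 p1] /andP[_ p2].
  rewrite leq_divRL// -(ler_nat R) [X in X <= _]natrM [X in _ <= X]natrM.
  rewrite natrB ?(ltnW nn')//.
  have n0 : (0 < n)%N by apply: leq_ltn_trans Ln.
  have n0R : (0 : R) < n%:R by rewrite ltr0n.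
  have n'0R : (0 : R) < n'%:R by rewrite ltr0n (ltn_trans n0).
  have s0R : (0 : R) < s%:R by rewrite ltr0n.
  (* For n < n' <= s the slope drops by at least 1 / s per index, as s^2 <= M. Slopes close to the
     same a / q differ by at most 2 / T, hence their indices by at most 2 s / T. *)
  have gap : (n'%:R - n%:R) / s%:R <= M%:R / n%:R ^+ 2 - M%:R / n'%:R ^+ 2 :> R.
    have -> : M%:R / n%:R ^+ 2 - M%:R / n'%:R ^+ 2 =
        (n'%:R - n%:R) * (M%:R * (n'%:R + n%:R) / (n%:R ^+ 2 * n'%:R ^+ 2)) :> R.
      by field; rewrite !gt_eqF.
    rewrite ler_wpM2l ?subr_ge0 ?ler_nat 1?ltnW//.
    rewrite ler_pdivlMr ?mulr_gt0 ?exprn_gt0// mulrC ler_pdivrMr//.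
    rewrite -!natrX -natrD -!natrM ler_nat.
    have -> : (n ^ 2 * n' ^ 2 = n' ^ 2 * n * n)%N by rewrite -[(n ^ 2)%N]mulnn mulnC mulnA.
    rewrite leq_mul//; last by rewrite ltnW// (leq_trans nn').
    rewrite leq_mul ?leq_addl//; apply: leq_trans sM; by rewrite leq_sqr.
  have q1 : 1 <= q%:R :> R by rewrite ler1n.
  set x := _ / _ in gap p1 *; set y := M%:R / n'%:R ^+ 2 in gap p2 *.
  clearbody x y.
  have xy : 0 <= x - y.
    by apply: le_trans gap; rewrite divr_ge0// subr_ge0 ler_nat ltnW.
  have xy1 : (x - y) * T%:R <= 2.
    apply: (@le_trans _ _ ((q%:R * x - q%:R * y) * T%:R)).
      by rewrite ler_wpM2r// -mulrBr ler_peMl.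
    have -> : q%:R * x - q%:R * y = (q%:R * x - a%:R) - (q%:R * y - a%:R) by ring.
    apply: le_trans (ler_wpM2r (ltW T0R) (le_trans (ler_norm _) (ler_normB _ _))) _.
    by rewrite mulrDl -[2]/(1 + 1) lerD.
  rewrite ler_pdivrMr// in gap.
  apply: (@le_trans _ _ ((x - y) * s%:R * T%:R)); first by rewrite ler_wpM2r.
  by rewrite mulrAC ler_wpM2r.
have badcount : (\sum_(L.+1 <= n < s.+1) (bad n : nat) <=
    k * ((k ^ 3).+1 * ((2 * s) %/ T).+1))%N.
  apply: (@leq_trans (\sum_(L.+1 <= n < s.+1) \sum_(q < k) \sum_(a < (k ^ 3).+1) P q a n)).
    apply: leq_sum => n _.
    case: (boolP (bad n)) => [/existsP[q /existsP[a Pa]]|//].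
    by rewrite (bigD1 q)//= (bigD1 a)//= Pa.
  rewrite exchange_big /=.
  apply: (@leq_trans (\sum_(q < k) (k ^ 3).+1 * ((2 * s) %/ T).+1)%N); last first.
    by rewrite sum_nat_const card_ord.
  apply: leq_sum => q _; rewrite exchange_big /=.
  apply: (@leq_trans (\sum_(a < (k ^ 3).+1) ((2 * s) %/ T).+1)%N); last first.
    by rewrite sum_nat_const card_ord.
  by apply: leq_sum => a _; apply: sum_pred_spread (spread q a).
rewrite (@big_cat_nat _ _ _ L.+1)//=.
apply: le_trans (ler_normD _ _) _.
have main := norm_sum_greedy k0 (ler0n R 5) saw1 good.
apply: le_trans (lerD (trivial_bound L) main) _.
have e1 : L%:R <= s%:R / k%:R :> R.
  by rewrite ler_pdivlMr// -natrM ler_nat leq_divM.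
have e2 : 5 / k%:R * (s - L)%:R <= 5 * (s%:R / k%:R) :> R.
  rewrite [leRHS]mulrCA mulrC ler_pM// ?divr_ge0//; last by rewrite ler_nat leq_subr.
have e3 : (\sum_(L.+1 <= i < s.+1) bad i)%:R <= 5 * (s%:R / k%:R) :> R.
  rewrite mulrA ler_pdivlMr// -!natrM ler_nat.
  apply: leq_trans (leq_mul badcount (leqnn k)) _.
  (* k^2 (k^3 + 1) <= 2 T, and then 4 s + 2 T <= 5 s. *)
  apply: (@leq_trans (2 * T * ((2 * s) %/ T).+1)).
    rewrite mulnAC mulnA leq_mul2r; apply/orP; right.
    have -> : (k * k * (k ^ 3).+1 = k ^ 5 + k ^ 2)%N.
      by rewrite mulnS mulnn -expnD addnC.
    by rewrite mul2n -addnn leq_add2l kle.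
  rewrite mulnS.
  have h1 : (2 * T <= s)%N by apply: leq_trans ks; exact: two_kle.
  have h2 : ((2 * s) %/ T * T <= 2 * s)%N by exact: leq_divM.
  by move: h1 h2; clear; lia.
have e4 : T%:R <= s%:R / k%:R :> R.
  rewrite ler_pdivlMr// -natrM ler_nat /T -expnSr.
  by apply: leq_trans ks; exact: kle.
(* 12 = 1 + 5 + 5 + 1: the indices up to [L], the blocks, the bad indices, the incomplete block at
   the end. *)
rewrite -[leRHS]mulrA; lra.
Qed.

(** * The divisor summatory function *)

Lemma is_derive_ge0_le (R : realType) (f df : R -> R) (a b : R) :
  0 < a -> a <= b -> (forall t : R, 0 < t -> is_derive t 1 f (df t)) ->
  (forall t : R, 0 < t -> 0 <= df t) -> f a <= f b.
Proof.
move=> a0 ab fdf df0.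
have pos (t : R) : t \in `[a, b]%R -> 0 < t.
  by rewrite in_itv /= => /andP[+ _]; exact: lt_le_trans.
have der (t : R) : t \in `[a, b]%R -> derivable f t 1 by move=> /pos/fdf[].
apply: (@ger0_derive1_le_cc R f a b) => //.
- by move=> t /(subset_itv_oo_cc) /der.
- move=> t /(subset_itv_oo_cc) /pos t0.
  by have H := fdf _ t0; rewrite derive1E derive_val df0.
- exact: derivable_within_continuous.
- by rewrite in_itv /= lexx.
- by rewrite in_itv /= lexx ab.
Qed.

(** At v = (k + 1) / k the right side is the trapezoidal rule for the integral of 1/t over
    [k, k + 1], an overestimate by convexity. *)
Lemma ln_le_trapezoid (R : realType) (v : R) :
  1 <= v -> ln v <= (v - v^-1) / 2.
Proof.
move=> v1.
rewrite -subr_ge0.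
pose f (t : R) := (t - t^-1) / 2 - ln t.
have <- : f 1 = 0 by rewrite /f ln1 invr1 !subrr mul0r subrr.
apply: (@is_derive_ge0_le R f (fun t => (1 - t^-1) ^+ 2 / 2)) => // t t0.
  have t0' : t != 0 by rewrite gt_eqF.
  have -> : (1 - t^-1) ^+ 2 / 2 =
      2^-1 *: (1 - - (id t) ^- 2 *: 1) - t^-1 :> R.
    by rewrite /GRing.scale /=; field.
  apply: is_deriveB (is_derive1_ln t0).
  have -> : (fun t : R => (t - t^-1) / 2) = 2^-1 \*: (id - (fun t => (id t)^-1)).
    by apply/funext => u; rewrite /= /GRing.scale /= mulrC.
  apply: is_deriveZ; apply: is_deriveB; exact: is_deriveV.
by rewrite divr_ge0// sqr_ge0.
Qed.

(** The left side is 2 (v - 1) / (v + 1); at v = (k + 1) / k it is the midpoint rule 1 / (k + 1/2),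
    an underestimate by convexity. *)
Lemma ln_ge_pade (R : realType) (v : R) : 1 <= v -> 2 - 4 / (v + 1) <= ln v.
Proof.
move=> v1.
rewrite -subr_ge0.
pose f (t : R) := ln t - (2 - 4 * (t + 1)^-1).
have <- : f 1 = 0 by rewrite /f ln1; field.
apply: (@is_derive_ge0_le R f (fun t => (t - 1) ^+ 2 / (t * (t + 1) ^+ 2))) => // t t0.
  have t0' : t != 0 by rewrite gt_eqF.
  have t1' : t + 1 != 0 by rewrite gt_eqF// ltr_wpDr.
  have -> : (t - 1) ^+ 2 / (t * (t + 1) ^+ 2) =
      t^-1 - (0 - 4 *: (- (t + 1) ^- 2 *: (1 + 0))) :> R.
    rewrite /GRing.scale /=; field.
    by rewrite t0' t1'.
  apply: (is_deriveB (is_derive1_ln t0)); apply: is_deriveB.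
  apply: is_deriveZ; apply: is_deriveV => //; exact: is_deriveD.
by rewrite divr_ge0 ?sqr_ge0// mulr_ge0 ?sqr_ge0// ltW.
Qed.

(** The term 1 / (2 n) is kept because the hyperbola method multiplies the error by about 2 n^2 and
    has to end with O(1). Euler's constant is squeezed between the increasing [a] and the decreasing
    [b]. *)
Lemma harmonic_sum_asymptotic (R : realType) (n : nat) : (0 < n)%N ->
  `|series (@harmonic R) n - (ln n%:R + euler_gamma R + (2 * n%:R)^-1)|
    <= (n%:R ^+ 2)^-1.
Proof.
pose a (n : nat) : R := series (@harmonic R) n.+1 - ln n.+1%:R - (2 * n.+1%:R)^-1.
pose b (n : nat) : R := a n + (n.+1%:R ^+ 2)^-1.
(* The increment is the trapezoidal value minus the logarithm; the upper bound is trapezoid minus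
   midpoint. *)
have step k : 0 <= a k.+1 - a k <= (2 * k.+1%:R * (k.+1%:R + 1) * (2 * k.+1%:R + 1))^-1.
  have k0 : (0 : R) < k.+1%:R by rewrite ltr0n.
  pose v : R := (k.+1%:R + 1) / k.+1%:R.
  have v1 : 1 <= v by rewrite /v ler_pdivlMr// mul1r lerDl.
  have lnE : ln k.+2%:R = ln k.+1%:R + ln v.
    rewrite -lnM ?posrE//; last by rewrite (lt_le_trans _ v1).
    congr ln; rewrite -natr1 /v; field.
    by rewrite gt_eqF.
  have := ln_le_trapezoid v1; have := ln_ge_pade v1.
  have -> : a k.+1 - a k = ((k.+1%:R)^-1 + (k.+1%:R + 1)^-1) / 2 - ln v.
    have serS : series (@harmonic R) k.+2 = series (@harmonic R) k.+1 + k.+2%:R^-1.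
      by rewrite seriesSr.
    rewrite /a serS lnE -[k.+2%:R]natr1; field.
    by rewrite !gt_eqF// ltr_wpDr.
  have -> : (v - v^-1) / 2 = ((k.+1%:R)^-1 + (k.+1%:R + 1)^-1) / 2.
    by rewrite /v; field; rewrite !gt_eqF// ltr_wpDr.
  have -> : 2 - 4 / (v + 1) = ((k.+1%:R)^-1 + (k.+1%:R + 1)^-1) / 2 -
      (2 * k.+1%:R * (k.+1%:R + 1) * (2 * k.+1%:R + 1))^-1.
    have k00 : (0 : R) <= k%:R by [].
    by rewrite /v; field; apply/and3P; split; apply: lt0r_neq0; lra.
  move: (_ / 2) (ln v) (2 * _ * _ * _)^-1 => A l B h1 h2.
  by apply/andP; split; lra.
have a_nd : nondecreasing_seq a.
  by apply/nondecreasing_seqP => k; have /andP[h _] := step k; rewrite -subr_ge0.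
have b_ni : nonincreasing_seq b.
  apply/nonincreasing_seqP => k; have /andP[_ h] := step k.
  have k0 : (0 : R) < k.+1%:R by rewrite ltr0n.
  suff : (2 * k.+1%:R * (k.+1%:R + 1) * (2 * k.+1%:R + 1))^-1 <=
      (k.+1%:R ^+ 2)^-1 - (k.+2%:R ^+ 2)^-1 :> R.
    move=> /(le_trans h); rewrite /b.
    by move: (k.+1%:R ^+ 2)^-1 (k.+2%:R ^+ 2)^-1 (a k) (a k.+1) => *; lra.
  rewrite -[k.+2%:R]natr1; move: (k.+1%:R : R) k0 => x x0.
  rewrite -subr_ge0.
  have -> : (x ^+ 2)^-1 - ((x + 1) ^+ 2)^-1 - (2 * x * (x + 1) * (2 * x + 1))^-1 =
     (7 * x ^+ 2 + 7 * x + 2) / (2 * x ^+ 2 * (x + 1) ^+ 2 * (2 * x + 1)).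
    field; rewrite !gt_eqF//; lra.
  by rewrite divr_ge0// ?addr_ge0 ?mulr_ge0 ?exprn_ge0//; lra.
have ab k : a k <= b k by rewrite lerDl invr_ge0 exprn_ge0.
have a_cvg : cvgn a.
  apply: nondecreasing_is_cvgn => //; exists (b 0%N) => _ [k _ <-].
  by apply: le_trans (ab k) _; exact: b_ni.
have half_harmonic : (fun k => (2 * k.+1%:R)^-1 : R) @ \oo --> (0 : R).
  have -> : (fun k => (2 * k.+1%:R)^-1 : R) = (fun k => 2^-1 * @harmonic R k).
    by apply/funext => k; rewrite invfM.
  by rewrite -[X in _ --> X](mulr0 (2^-1 : R)); apply: cvgM; [exact: cvg_cst|exact: cvg_harmonic].
have gammaE : euler_gamma R = limn a.
  apply/cvg_lim => //; rewrite -cvg_shiftS.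
  have -> : (fun k => series (@harmonic R) k.+1 - ln k.+1%:R) =
     (fun k => a k + (2 * k.+1%:R)^-1) by apply/funext => k; rewrite /a subrK.
  have H : (fun k => a k + (2 * k.+1%:R)^-1) @ \oo --> limn a + 0.
    exact: cvgD a_cvg half_harmonic.
  by rewrite addr0 in H.
case: n => // n _.
have lo : a n <= euler_gamma R by rewrite gammaE; exact: nondecreasing_cvgn_le.
have up : euler_gamma R <= b n.
  rewrite gammaE; apply: limr_le => //; exists n => // k /= nk.
  by apply: le_trans (ab k) _; exact: b_ni.
move: lo up; rewrite /b /a.
move: (2 * _)^-1 (_ ^+ 2)^-1 (series _ _) (ln _) => u w h l lo up.
by rewrite ler_norml; apply/andP; split; lra.
Qed.

(** The sum of tau(n) over n <= N, as the number of pairs (a, b) with a b <= N, counted by [a]. *)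
Definition divisor_summatory (N : nat) : nat := (\sum_(1 <= a < N.+1) N %/ a)%N.

Lemma sum_leq_mul (a M N : nat) : (0 < a)%N ->
  (\sum_(1 <= b < N.+1) (a * b <= M)%N = minn N (M %/ a))%N.
Proof.
move=> a0; elim: N => [|N IH]; first by rewrite big_geq// min0n.
by rewrite big_nat_recr//= IH mulnC -leq_divRL//; case: leqP => /=; lia.
Qed.

(** Of two factors with product at most M < (s + 1)^2 one is at most [s]; the [s ^ 2] pairs with
    both at most [s] are counted twice on the right. They are added on the left to avoid a
    subtraction in [nat]. *)
Lemma divisor_summatory_hyperbola (M s : nat) : (s ^ 2 <= M)%N -> (M < s.+1 ^ 2)%N ->
  (divisor_summatory M + s ^ 2 = 2 * \sum_(1 <= a < s.+1) M %/ a)%N.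
Proof.
move=> sM Ms.
have le_sM : (s <= M)%N by apply: leq_trans sM; rewrite -mulnn; case: (s) => // k; rewrite leq_pmulr.
have divE a : (0 < a)%N -> (M %/ a = \sum_(1 <= b < M.+1) (a * b <= M))%N.
  by move=> a0; rewrite sum_leq_mul//; apply/esym/minn_idPr/leq_div.
rewrite /divisor_summatory (@big_cat_nat _ _ _ s.+1)//= mul2n -addnn -addnA; congr addn.
have -> : (\sum_(s.+1 <= a < M.+1) M %/ a =
    \sum_(1 <= b < s.+1) \sum_(s.+1 <= a < M.+1) (b * a <= M))%N.
  rewrite exchange_big /=; apply: eq_big_nat => a /andP[sa _].
  rewrite divE; last by apply: leq_ltn_trans sa.
  rewrite (@big_cat_nat _ _ _ s.+1)//= [X in (_ + X)%N]big_nat_cond [X in (_ + X)%N]big1 ?addn0.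
    by apply: eq_bigr => b _; rewrite mulnC.
  move=> b /andP[/andP[sb _] _]; apply/eqP; rewrite eqb0 -ltnNge.
  by apply: leq_trans Ms _; rewrite -mulnn leq_mul.
have -> : (s ^ 2 = \sum_(1 <= b < s.+1) s)%N by rewrite sum_nat_const_nat subn1 mulnn.
rewrite -big_split /=; apply: eq_big_nat => b /andP[b0 bs].
rewrite (divE b)// [RHS](@big_cat_nat _ _ _ s.+1)//= addnC; congr addn.
rewrite sum_leq_mul//; apply/esym/minn_idPl; rewrite leq_divRL//.
by apply: leq_trans sM; rewrite -mulnn leq_mul.
Qed.

Lemma truncn_divr_nat (R : archiRealFieldType) (M n : nat) : (0 < n)%N ->
  Num.truncn (M%:R / n%:R : R) = (M %/ n)%N.
Proof.
move=> n0; have n0R : (0 : R) < n%:R by rewrite ltr0n.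
apply: truncn_def; rewrite ler_pdivlMr// ltr_pdivrMr// -!natrM ler_nat ltr_nat.
by rewrite leq_divM /= ltn_ceil.
Qed.

Lemma sum_divn_saw (R : archiRealFieldType) (M s : nat) :
  (\sum_(1 <= n < s.+1) M %/ n)%N%:R =
  M%:R * (\sum_(1 <= n < s.+1) n%:R^-1) - \sum_(1 <= n < s.+1) saw (M%:R / n%:R) - s%:R / 2 :> R.
Proof.
have -> : s%:R / 2 = \sum_(1 <= n < s.+1) 2^-1 :> R.
  by rewrite sumr_const_nat subn1 mulr_natl.
rewrite natr_sum mulr_sumr -!sumrB; apply: eq_big_nat => n /andP[n0 _].
by rewrite /saw truncn_divr_nat//; ring.
Qed.

Lemma ln_ge_frac (R : realType) (u : R) : 0 <= u -> u / (1 + u) <= ln (1 + u).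
Proof.
move=> u0; have u1 : 0 < 1 + u by rewrite ltr_pwDl.
have h : -1 < - (u / (1 + u)) by rewrite ltrN2 ltr_pdivrMr// mul1r ltrDr.
have := le_ln1Dx h.
have -> : 1 - u / (1 + u) = (1 + u)^-1 by field; rewrite gt_eqF.
by rewrite lnV ?posrE// lerN2.
Qed.

Definition divisor_main (R : realType) (y : R) : R :=
  y * ln y + (2 * euler_gamma R - 1) * y.

(** Write M = s^2 (1 + u); since M - s^2 <= 2 s, the product s u is at most 2. Once the harmonic sum
    is replaced by its asymptotics, s u + s^2 (u - (1 + u) ln(1 + u)) is left, and the bracket lies
    in [-u^2, 0]. *)
Lemma hyperbola_main_term (R : realType) (M s : nat) :
  (0 < s)%N -> (s ^ 2 <= M)%N -> (M < s.+1 ^ 2)%N ->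
  `|2 * M%:R * series (@harmonic R) s - s%:R - s%:R ^+ 2 - divisor_main M%:R| <= 10.
Proof.
move=> s0 sM Ms.
have := harmonic_sum_asymptotic R s0.
set H := series _ _; set g := euler_gamma R.
have s0R : (0 : R) < s%:R by rewrite ltr0n.
have s1R : (1 : R) <= s%:R by rewrite ler1n.
have M0R : (0 : R) < M%:R by rewrite ltr0n; apply: leq_trans sM; rewrite expn_gt0 s0.
have {sM} sMR : s%:R ^+ 2 <= M%:R :> R by rewrite -natrX ler_nat.
have {Ms} MsR : M%:R <= s%:R ^+ 2 + 2 * s%:R :> R.
  rewrite -natrX -natrM -natrD ler_nat -ltnS; apply: leq_trans Ms _.
  by rewrite -addn1 sqrnD; lia.
rewrite /divisor_main -/g.
move: (M%:R : R) (s%:R : R) M0R s0R s1R sMR MsR => m t m0 t0 t1 tm mt.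
move=> HE.
pose r := m - t ^+ 2; pose u := r / t ^+ 2.
have t20 : 0 < t ^+ 2 by rewrite exprn_gt0.
have u0 : 0 <= u by rewrite divr_ge0 ?subr_ge0// ltW.
have u1 : 0 < 1 + u by rewrite ltr_pwDl.
have mE : m = t ^+ 2 * (1 + u) by rewrite /u /r; field; rewrite gt_eqF.
have lnm : ln m = 2 * ln t + ln (1 + u).
  by rewrite mE lnM ?posrE// lnXn// mulr_natl.
have l1 : ln (1 + u) <= u by apply: le_ln1Dx; lra.
have l2 : u <= (1 + u) * ln (1 + u).
  by rewrite mulrC -ler_pdivrMr// ln_ge_frac.
have tut : t * u <= 2.
  have -> : t * u = r / t by rewrite /u; field; rewrite gt_eqF.
  by rewrite ler_pdivrMr// /r lerBlDl.
have tu0 : 0 <= t * u by rewrite mulr_ge0// ltW.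
have -> : 2 * m * H - t - t ^+ 2 - (m * ln m + (2 * g - 1) * m) =
   2 * m * (H - (ln t + g + (2 * t)^-1))
   + (t * u + t ^+ 2 * (u - (1 + u) * ln (1 + u))).
  rewrite lnm {1 2 3 4}mE; field.
  by rewrite gt_eqF.
apply: le_trans (ler_normD _ _) _.
(* 6 bounds 2 m / t^2 <= 2 + 4 / t; the other part lies in [-4, 2]. *)
have -> : (10 : R) = 6 + 4 by lra.
apply: lerD.
  rewrite normrM gtr0_norm ?mulr_gt0//.
  apply: le_trans (ler_wpM2l _ HE) _; first by rewrite mulr_ge0// ltW.
  rewrite ler_pdivrMr//; nra.
have ub : u - (1 + u) * ln (1 + u) <= 0 by lra.
have lb : - u ^+ 2 <= u - (1 + u) * ln (1 + u).
  have : (1 + u) * ln (1 + u) <= (1 + u) * u by rewrite ler_pM2l.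
  lra.
have tlb : - 4 <= t ^+ 2 * (u - (1 + u) * ln (1 + u)).
  apply: le_trans (ler_wpM2l (ltW t20) lb).
  have : (t * u) ^+ 2 <= 2 ^+ 2 by rewrite ler_sqr ?nnegrE.
  by rewrite exprMn; lra.
have tub : t ^+ 2 * (u - (1 + u) * ln (1 + u)) <= 0 by rewrite pmulr_rle0.
rewrite ler_norml; apply/andP; split; lra.
Qed.

Lemma exists_nat_root (j n : nat) : (0 < j)%N ->
  exists k, (k ^ j <= n)%N && (n < k.+1 ^ j)%N.
Proof.
move=> j0; have ex0 : exists k, (k ^ j <= n)%N by exists 0%N; rewrite exp0n.
have bound k : (k ^ j <= n)%N -> (k <= n)%N.
  apply: leq_trans; case: k => // k; rewrite -{1}[k.+1]expn1 leq_pexp2l//.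
case: (ex_maxnP ex0 bound) => k kn kmax; exists k; rewrite kn ltnNge.
by apply/negP => /kmax; rewrite ltnn.
Qed.

(** For [k] the integer part of s^(1/20), s / k <= 2 s / (k + 1) <= 2 s^(19/20) <= 2 M^(19/40). The
    constant is 10 from the main term plus 2 * 12 * 2 from the sawtooth sum. *)
Lemma divisor_summatory_asymptotic (R : realType) (M : nat) : (0 < M)%N ->
  `|(divisor_summatory M)%:R - divisor_main M%:R : R| <= 58 * M%:R `^ (19 / 40).
Proof.
move=> M0.
have [s /andP[sM Ms]] := @exists_nat_root 2 M isT.
have s0 : (0 < s)%N by case: s sM Ms => // _; rewrite exp1n ltnS leqNgt M0.
have [k /andP[ks sk]] := @exists_nat_root 20 s isT.
have k0 : (0 < k)%N by case: k ks sk => // _; rewrite exp1n ltnS leqNgt s0.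
have saw_le := norm_sum_saw_divn R k0 sM Ms ks.
have main := hyperbola_main_term R s0 sM Ms.
have := congr1 (fun n => n%:R : R) (divisor_summatory_hyperbola sM Ms).
rewrite natrD natrX natrM => /(canRL (addrK _)) ->.
have harmE : \sum_(1 <= n < s.+1) n%:R^-1 = series (@harmonic R) s.
  by rewrite big_add1 /=.
rewrite sum_divn_saw harmE.
set H := series _ _ in main *; set S := \sum_(_ <= _ < _) _ in saw_le *.
have -> : 2 * (M%:R * H - S - s%:R / 2) - s%:R ^+ 2 - divisor_main M%:R =
  (2 * M%:R * H - s%:R - s%:R ^+ 2 - divisor_main M%:R) - 2 * S by field.
apply: le_trans (ler_normB _ _) _; rewrite normrM normr_nat.
have M1 : 1 <= M%:R `^ (19 / 40) :> R.
  have h : 1 `^ (19 / 40) <= M%:R `^ (19 / 40) :> R.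
    by rewrite ge0_ler_powR ?nnegrE ?ler1n//; lra.
  by rewrite powR1 in h.
have s0R : (0 : R) < s%:R by rewrite ltr0n.
have k0R : (0 : R) < k%:R by rewrite ltr0n.
suff sk_le : s%:R / k%:R <= 2 * M%:R `^ (19 / 40) :> R.
  rewrite -mulrA in saw_le; lra.
have root_le : s%:R `^ (1 / 20) <= k.+1%:R :> R.
  have -> : k.+1%:R = (k.+1%:R ^+ 20) `^ (1 / 20) :> R.
    rewrite -powR_mulrn// -powRrM.
    have -> : 20%:R * (1 / 20) = 1 :> R by field.
    by rewrite powRr1.
  apply: ge0_ler_powR; rewrite ?nnegrE ?exprn_ge0//.
  by rewrite -natrX ler_nat ltnW.
have sM_le : s%:R `^ (19 / 20) <= M%:R `^ (19 / 40) :> R.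
  have -> : 19 / 20 = 2%:R * (19 / 40) :> R by field.
  rewrite powRrM powR_mulrn// ge0_ler_powR ?nnegrE ?exprn_ge0//.
  by rewrite -natrX ler_nat.
apply: le_trans (ler_wpM2l _ sM_le) => //.
have sE : s%:R = s%:R `^ (19 / 20) * s%:R `^ (1 / 20) :> R.
  rewrite -powRD; last by rewrite (gt_eqF s0R) implybT.
  have -> : 19 / 20 + 1 / 20 = 1 :> R by field.
  by rewrite powRr1// ltW.
rewrite ler_pdivrMr// {1}sE mulrAC [leRHS]mulrC ler_wpM2l ?powR_ge0//.
apply: le_trans root_le _; rewrite -natrM ler_nat; lia.
Qed.

(** * Reduction to a sum over prime powers *)

Lemma mobius_prime_mul (p e : nat) : prime p -> (0 < e)%N -> ~~ (p %| e)%N ->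
  mobius (p * e) = - mobius e.
Proof.
move=> pp e0 pe; have p0 := prime_gt0 pp.
have pnotin : p \notin primes e by rewrite mem_primes pp e0 /= .
have perm : perm_eq (primes (p * e)) (p :: primes e).
  apply: uniq_perm; rewrite ?primes_uniq//= ?pnotin ?primes_uniq//.
  by move=> q; rewrite primesM// primes_prime// !inE.
rewrite /mobius muln_gt0 p0 e0 /= (perm_all _ perm) (perm_size perm) /=.
rewrite lognM// logn_prime// eqxx (@logn_coprime p e) ?prime_coprime//=.
have -> : all (fun q => logn q (p * e) == 1%N) (primes e) =
          all (fun q => logn q e == 1%N) (primes e).
  apply: eq_in_all => q qe; rewrite lognM// logn_prime//.
  by have -> : (q == p) = false by apply: contraNF pnotin => /eqP <-.
by case: ifP; rewrite ?oppr0// exprS mulN1r.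
Qed.

Lemma mobius_sqr_dvd (p n : nat) : prime p -> (p ^ 2 %| n)%N -> mobius n = 0.
Proof.
move=> pp pn; rewrite /mobius; case: posnP => [->|n0]//=.
case: ifP => // /allP /(_ p).
have p2 : (2 <= logn p n)%N by rewrite -(pfactor_dvdn _ pp).
have -> : p \in primes n by rewrite -logn_gt0; apply: leq_trans p2.
by move=> /(_ isT) /eqP l1; rewrite l1 in p2.
Qed.

(** For a prime p dividing n, a divisor p e with p | e contributes 0, and one with p not dividing e
    cancels against e. These e are precisely the divisors of n prime to p. *)
Lemma sum_mobius_divisors (n : nat) : (1 < n)%N ->
  \sum_(d <- divisors n) mobius d = 0.
Proof.
move=> n1; have n0 := ltnW n1.
pose p := pdiv n; have pp : prime p by exact: pdiv_prime.
have p0 := prime_gt0 pp.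
have pn : (p %| n)%N by exact: pdiv_dvd.
have np0 : (0 < n %/ p)%N by rewrite divn_gt0// dvdn_leq.
rewrite (bigID (fun d => p %| d)%N) /= -big_filter -[X in _ + X]big_filter.
have perm1 : perm_eq [seq d <- divisors n | (p %| d)%N]
    [seq (p * e)%N | e <- divisors (n %/ p)].
  apply: uniq_perm; first by rewrite filter_uniq// divisors_uniq.
    rewrite map_inj_uniq ?divisors_uniq// => x y /eqP.
    by rewrite eqn_pmul2l// => /eqP.
  move=> d; rewrite mem_filter -dvdn_divisors//.
  apply/andP/mapP => [[/dvdnP[e ->] ed]|[e]].
    exists e; last by rewrite mulnC.
    by rewrite -dvdn_divisors// dvdn_divRL.
  by rewrite -dvdn_divisors// => ed ->; rewrite dvdn_mulr// mulnC -dvdn_divRL.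
rewrite (perm_big _ perm1) /= big_map (bigID (fun d => p %| d)%N) /= big1 ?add0r; last first.
  move=> e /dvdnP[c ->]; apply: (mobius_sqr_dvd pp).
  by rewrite -mulnn [(c * p)%N]mulnC mulnA dvdn_mulr.
have perm : perm_eq [seq d <- divisors n | ~~ (p %| d)%N]
    [seq d <- divisors (n %/ p) | ~~ (p %| d)%N].
  apply: uniq_perm; rewrite ?filter_uniq ?divisors_uniq// => d.
  rewrite !mem_filter -!dvdn_divisors//; case: (boolP (p %| d)%N) => //= pd.
  by rewrite dvdn_divRL// Gauss_dvd ?pn ?andbT// coprime_sym prime_coprime.
rewrite [X in _ + X](perm_big _ perm) /= !big_filter -big_split /= big_seq_cond big1//.
move=> e /andP[ed pe]; rewrite mobius_prime_mul ?addNr//.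
by move: ed; rewrite -dvdn_divisors//; apply: dvdn_gt0.
Qed.

(** Gives divisor sums a range independent of [n], so that sums can be exchanged. *)
Lemma sum_divisors_nat (V : nmodType) (n N : nat) (F : nat -> V) :
  (0 < n)%N -> (n <= N)%N ->
  \sum_(d <- divisors n) F d = \sum_(1 <= d < N.+1 | (d %| n)%N) F d.
Proof.
move=> n0 nN; rewrite -[RHS]big_filter; apply: perm_big.
apply: uniq_perm; rewrite ?divisors_uniq ?filter_uniq ?iota_uniq// => d.
rewrite mem_filter mem_index_iota -dvdn_divisors//.
case: (boolP (d %| n)%N) => //= dn.
by rewrite (dvdn_gt0 n0 dn) ltnS (leq_trans _ nN)// dvdn_leq.
Qed.

(** Associativity of convolution, written out: the sum over d = e c is regrouped by [c], and the
    inner sum of [mobius] over the divisors of n / c vanishes unless c = n. *)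
Lemma mobius_inversion (K : comNzRingType) (f : nat -> K) (n : nat) : (0 < n)%N ->
  \sum_(d <- divisors n) dirichlet_conv (fun d => (mobius d)%:~R) f d = f n.
Proof.
move=> n0.
have convE d : (0 < d)%N -> (d <= n)%N ->
    dirichlet_conv (fun d => (mobius d)%:~R) f d =
    \sum_(1 <= c < n.+1) \sum_(1 <= e < n.+1) (if (e * c == d)%N then (mobius e)%:~R * f c else 0).
  move=> d0 dn; rewrite /dirichlet_conv (sum_divisors_nat _ d0 dn) exchange_big /= big_mkcond.
  apply: eq_big_nat => e /andP[e0 _]; case: ifP => [/dvdnP[c dE]|ed].
    have c0 : (0 < c)%N by move: d0; rewrite dE muln_gt0 => /andP[].
    rewrite dE mulnK// (bigD1_seq c) ?iota_uniq//=; last first.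
      by rewrite mem_index_iota c0 ltnS (leq_trans _ dn)// dE leq_pmulr.
    rewrite [(e * c)%N]mulnC eqxx big1 ?addr0// => b bc.
    by rewrite mulnC eqn_pmul2r// (negbTE bc).
  rewrite big1// => c _; case: eqP => // dE.
  by rewrite -dE dvdn_mulr in ed.
rewrite (sum_divisors_nat _ n0 (leqnn n)).
rewrite big_mkcond /=.
transitivity (\sum_(1 <= c < n.+1) \sum_(1 <= e < n.+1)
    (if (e * c %| n)%N then (mobius e)%:~R * f c else 0)).
  transitivity (\sum_(1 <= d < n.+1) \sum_(1 <= c < n.+1) \sum_(1 <= e < n.+1)
      (if (d %| n)%N && (e * c == d)%N then (mobius e)%:~R * f c else 0)).
    apply: eq_big_nat => d /andP[d0 dn]; case: ifP => _; first by rewrite convE.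
    by rewrite big1// => c _; rewrite big1.
  rewrite exchange_big /=; apply: eq_big_nat => c /andP[c0 _].
  rewrite exchange_big /=; apply: eq_big_nat => e /andP[e0 _].
  case: ifP => [ecn|necn]; last first.
    by rewrite big1// => d _; case: ifP => // /andP[dn /eqP dE]; rewrite dE dn in necn.
  rewrite (bigD1_seq (e * c)%N) ?iota_uniq//=; last first.
    by rewrite mem_index_iota muln_gt0 e0 c0 ltnS dvdn_leq.
  rewrite ecn eqxx big1 ?addr0// => d; rewrite eq_sym => /negbTE ->.
  by rewrite andbF.
rewrite (bigD1_seq n) ?iota_uniq//=; last by rewrite mem_index_iota n0 ltnS leqnn.
rewrite [X in _ + X]big_seq_cond [X in _ + X]big1 ?addr0; last first.
  move=> c; rewrite mem_index_iota => /andP[/andP[c0 cn] cnn].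
  case: (boolP (c %| n)%N) => [cdn|ncdn]; last first.
    rewrite big1// => e _; case: ifP => // h; case/negP: ncdn.
    by apply: dvdn_trans h; rewrite dvdn_mull.
  have nc1 : (1 < n %/ c)%N.
    rewrite ltn_divRL// mul1n; move: cn; rewrite ltnS leq_eqVlt (negbTE cnn)//.
  have : (\sum_(1 <= e < n.+1 | (e %| n %/ c)%N) mobius e)%:~R = 0 :> K.
    by rewrite -(sum_divisors_nat _ (ltnW nc1)) ?leq_div// sum_mobius_divisors.
  rewrite rmorph_sum /= => h.
  transitivity ((\sum_(1 <= e < n.+1 | (e %| n %/ c)%N) (mobius e)%:~R) * f c).
    rewrite mulr_suml [RHS]big_mkcond /=.
    by apply: eq_bigr => e _; rewrite dvdn_divRL.
  by rewrite h mul0r.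
rewrite (bigD1_seq 1%N) ?iota_uniq//=; last by rewrite mem_index_iota.
rewrite mul1n dvdnn big_seq_cond big1 ?addr0; last first.
  move=> e; rewrite mem_index_iota => /andP[/andP[e0 _] e1].
  case: ifP => // /(dvdn_leq n0); rewrite -{2}[n]mul1n leq_pmul2r// leq_eqVlt (negbTE e1) /=.
  by rewrite ltnNge e0.
by rewrite /mobius /= mul1r.
Qed.

Lemma sum_multiples (V : nmodType) (d N : nat) (G : nat -> V) : (0 < d)%N ->
  \sum_(1 <= m < N.+1 | (d %| m)%N) G m = \sum_(1 <= a < (N %/ d).+1) G (d * a)%N.
Proof.
move=> d0; elim: N => [|N IH]; first by rewrite div0n !big_geq.
rewrite big_mkcond big_nat_recr//= -big_mkcond IH divnS//.
case: (boolP (d %| N.+1)%N) => [dN|_]; last by rewrite addr0.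
rewrite add1n [RHS]big_nat_recr//=; congr (_ + G _).
have := divnS N d0; rewrite dN add1n => <-.
by rewrite mulnC divnK.
Qed.

(** With m = d a and n = d b the condition reads a b <= N / d^2. *)
Lemma count_multiples_mul_le (d N : nat) : (0 < d)%N ->
  (\sum_(1 <= m < N.+1 | d %| m) \sum_(1 <= n < N.+1 | d %| n) (m * n <= N) =
   divisor_summatory (N %/ d ^ 2))%N.
Proof.
move=> d0; rewrite (sum_multiples (V := nat))//.
under eq_bigr do rewrite (sum_multiples (V := nat))//.
have d20 : (0 < d ^ 2)%N by rewrite expn_gt0 d0.
have sub : (N %/ d ^ 2 <= N %/ d)%N by rewrite leq_div2l// -mulnn leq_pmulr.
(* Letting [a] run up to N / d is harmless: beyond N / d^2 the quotient is 0. *)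
rewrite /divisor_summatory [RHS](_ : _ = \sum_(1 <= a < (N %/ d).+1) N %/ d ^ 2 %/ a)%N.
  apply: eq_big_nat => a /andP[a0 _].
  under eq_bigr do rewrite mulnA.
  rewrite sum_leq_mul ?muln_gt0 ?d0 ?a0//.
  have -> : (d * a * d = d ^ 2 * a)%N by rewrite mulnAC mulnn.
  by rewrite divnMA; apply/minn_idPr; apply: leq_trans sub; exact: leq_div.
rewrite [RHS](@big_cat_nat _ _ _ (N %/ d ^ 2).+1)//= [X in (_ + X)%N]big_nat_cond.
by rewrite [X in (_ + X)%N]big1 ?addn0// => a /andP[/andP[h _] _]; rewrite divn_small.
Qed.

Lemma gcd_sum_divisor_summatory (R : realType) (f : nat -> R[i]) (x : R) : 0 <= x ->
  gcd_sum f x = \sum_(1 <= d < (Num.truncn x).+1)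
    dirichlet_conv (fun d => (mobius d)%:~R) f d *
    (divisor_summatory (Num.truncn x %/ d ^ 2))%:R.
Proof.
move=> x0; rewrite /gcd_sum; set N := Num.truncn x.
set h := dirichlet_conv _ f.
transitivity (\sum_(1 <= m < N.+1) \sum_(1 <= n < N.+1) \sum_(1 <= d < N.+1)
    (if [&& (d %| m)%N, (d %| n)%N & (m * n <= N)%N] then h d else 0)).
  apply: eq_big_nat => m /andP[m0 mN]; rewrite big_mkcond.
  apply: eq_big_nat => n /andP[n0 nN]; rewrite -truncn_ge_nat// -/N.
  case: ifP => mnN; last by rewrite big1// => d _; rewrite !andbF.
  have g0 : (0 < gcdn m n)%N by rewrite gcdn_gt0 m0.
  have gN : (gcdn m n <= N)%N by rewrite (leq_trans (dvdn_leq m0 (dvdn_gcdl m n))).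
  rewrite -(mobius_inversion f g0) (sum_divisors_nat _ g0 gN) big_mkcond.
  by apply: eq_bigr => d _; rewrite dvdn_gcd andbT.
under eq_bigr do rewrite exchange_big.
rewrite exchange_big /=; apply: eq_big_nat => d /andP[d0 _].
rewrite -count_multiples_mul_le// natr_sum mulr_sumr [RHS]big_mkcond /=.
apply: eq_bigr => m _; case: ifP => dm /=; last by rewrite big1.
rewrite natr_sum mulr_sumr [RHS]big_mkcond /=.
apply: eq_bigr => n _; case: (d %| n)%N => //=.
by case: (m * n <= N)%N; rewrite ?mulr1 ?mulr0.
Qed.

Lemma prime_pow_inj (p q m n : nat) : prime p -> prime q -> (0 < m)%N ->
  (p ^ m = q ^ n)%N -> p = q /\ m = n.
Proof.
move=> pp qp m0 E.
have pq : p = q.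
  have : (p %| q ^ n)%N by rewrite -E dvdn_exp.
  by rewrite Euclid_dvdX// => /andP[+ _]; rewrite dvdn_prime2// => /eqP.
by split=> //; move: E; rewrite pq => /expnI; apply; exact: prime_gt1.
Qed.

(** Both [p] and [nu] are at most p^nu, so all [P] and [V] beyond [N] catch every contributing prime
    power, each with a unique representation. A free [P] permits the later passage to the limit. *)
Lemma sum_prime_power_support (K : nzRingType) (h g G : nat -> K) (Q S : set nat)
    (N P V : nat) :
  (forall p, Q p -> prime p) -> (forall nu, S nu -> (0 < nu)%N) ->
  (forall n, (0 < n)%N -> ~ (exists p nu, [/\ Q p, S nu & n = (p ^ nu)%N]) -> h n = 0) ->
  (forall p nu, Q p -> S nu -> h (p ^ nu)%N = g p) ->
  (forall n, (N < n)%N -> G n = 0) -> (N < P)%N -> (N < V)%N ->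
  \sum_(1 <= d < N.+1) h d * G d =
  \sum_(0 <= p < P | p \in Q) \sum_(0 <= nu < V | nu \in S) g p * G (p ^ nu)%N.
Proof.
move=> hQ hS h0 hg GN NP NV.
transitivity (\sum_(1 <= d < N.+1) \sum_(0 <= p < P | p \in Q)
    \sum_(0 <= nu < V | nu \in S) (if (p ^ nu == d)%N then g p * G d else 0)).
  apply: eq_big_nat => d /andP[d0 dN].
  have [[p [nu [Qp Snu dE]]]|none] :=
      pselect (exists p nu, [/\ Q p, S nu & d = (p ^ nu)%N]); last first.
    rewrite h0// mul0r big1// => p /set_mem Qp; rewrite big1// => nu /set_mem Snu.
    by case: eqP => // E; case: none; exists p, nu.
  have p2 := prime_gt1 (hQ p Qp); have nu0 := hS nu Snu.
  have nud : (nu < d)%N by rewrite dE ltn_expl.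
  have pd : (p <= d)%N by rewrite dE -{1}[p]expn1 leq_pexp2l// ltnW.
  rewrite [RHS]big_mkcond (bigD1_seq p) ?iota_uniq//=; last first.
    by rewrite mem_index_iota /= (leq_ltn_trans pd)// (leq_ltn_trans _ NP).
  rewrite mem_set// big_mkcond (bigD1_seq nu) ?iota_uniq//=; last first.
    by rewrite mem_index_iota /= (ltn_trans nud)// (leq_ltn_trans _ NV).
  rewrite mem_set// dE eqxx hg// big1 ?addr0 => [|mu muN]; last first.
    case: ifP => // /set_mem Smu; case: eqP => // E.
    by have [_ mE] := prime_pow_inj (hQ p Qp) (hQ p Qp) (hS _ Smu) E; rewrite mE eqxx in muN.
  rewrite big1 ?addr0// => q qp; case: ifP => // /set_mem Qq.
  rewrite big1// => mu /set_mem Smu; case: eqP => // E.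
  by have [qE _] := prime_pow_inj (hQ q Qq) (hQ p Qp) (hS _ Smu) E; rewrite qE eqxx in qp.
rewrite exchange_big /=; apply: eq_bigr => p /set_mem Qp.
rewrite exchange_big /=; apply: eq_bigr => nu _.
have p0 : (0 < p ^ nu)%N by rewrite expn_gt0 prime_gt0//; exact: hQ.
have [le|gt] := leqP (p ^ nu) N; last first.
  rewrite GN// mulr0 big_nat big1// => d /andP[_ dN]; case: eqP => // E.
  by move: gt; rewrite E ltnNge -ltnS dN.
rewrite (bigD1_seq (p ^ nu)%N) ?iota_uniq//=; last by rewrite mem_index_iota p0 ltnS.
by rewrite eqxx big1 ?addr0// => d; rewrite eq_sym => /negbTE ->.
Qed.

(** * Bounds for the remainder terms *)

Lemma ln_le_powR (R : realType) (s u : R) : 0 < s -> 0 < u -> ln u <= s^-1 * u `^ s.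
Proof.
move=> s0 u0; rewrite mulrC ler_pdivlMr// mulrC -ln_powR.
by apply/ltW/ln_sublinear; exact: powR_gt0.
Qed.

Lemma powR_ge1 (R : realType) (u s : R) : 1 <= u -> 0 <= s -> 1 <= u `^ s.
Proof. by move=> u1 s0; rewrite -(powRr0 u) ler_powR. Qed.

(** u^(1/4) is the room between the tail n^(-3/2) of the envelope and the still summable
    n^(-5/4). *)
Lemma exists_ln1D_powR_le (R : realType) (eta : R) : 0 <= eta ->
  exists2 K : R, 0 <= K & forall u, 1 <= u -> (1 + ln u) `^ eta <= K * u `^ (1 / 4).
Proof.
(* Chosen so that s eta <= 1/4; [eta + 1] is positive even for [eta = 0]. *)
move=> eta0; pose s : R := (4 * (eta + 1))^-1.
have s0 : 0 < s by rewrite invr_gt0; lra.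
exists ((1 + s^-1) `^ eta); first exact: powR_ge0.
move=> u u1; have u0 : 0 < u by apply: lt_le_trans u1.
have l0 : 0 <= ln u by exact: ln_ge0.
have h : 1 + ln u <= (1 + s^-1) * u `^ s.
  rewrite mulrDl mul1r lerD ?ln_le_powR//.
  by apply: powR_ge1 => //; exact: ltW.
have h0 : 0 <= 1 + s^-1 by rewrite addr_ge0// invr_ge0 ltW.
apply: le_trans (ge0_ler_powR eta0 _ _ h) _.
- by rewrite nnegrE addr_ge0.
- by rewrite nnegrE mulr_ge0// powR_ge0.
rewrite powRM ?powR_ge0// ler_wpM2l ?powR_ge0// -powRrM ler_powR//.
rewrite /s mulrC ler_pdivrMr; lra.
Qed.

(* Envelope of the error term in the divisor problem: the first power is the
   smaller one for [y >= 1], the second one, which makes the tail over the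
   [d] with [d ^ 2 > x] summable, for [y <= 1]. *)
Definition decay (R : realType) (y : R) : R :=
  Num.min (y `^ (19 / 40)) (y `^ (3 / 4)).

Lemma decay_ge0 (R : realType) (y : R) : 0 <= decay y.
Proof. by rewrite /decay le_min !powR_ge0. Qed.

Lemma decay_div_le (R : realType) (y c : R) : 0 <= y -> 1 <= c ->
  decay (y / c) <= c `^ (- (19 / 40)) * decay y.
Proof.
move=> y0 c1; have c0 : 0 < c by apply: lt_le_trans c1.
have cE s : (y / c) `^ s = c `^ (- s) * y `^ s.
  rewrite powRM ?invr_ge0 ?(ltW c0)// mulrC -(powR_inv1 (ltW c0)) -powRrM.
  by rewrite mulN1r.
rewrite /decay [in leRHS]minr_pMr ?powR_ge0// le_min !cE.
apply/andP; split; first by rewrite ge_min lexx.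
rewrite ge_min; apply/orP; right.
rewrite ler_wpM2r ?powR_ge0// ler_powR//; lra.
Qed.

(** The divisor sum sees only the integer part of [y]; moving the main term from there to [y] costs
    a logarithm, which y^(19/40) absorbs. *)
Lemma divisor_main_diff (R : realType) (y M : R) : 1 <= M -> M <= y -> y <= M + 1 ->
  `|divisor_main y - divisor_main M| <= ln y + 1 + `|2 * euler_gamma R - 1|.
Proof.
move=> M1 My yM.
have M0 : 0 < M by lra.
have y0 : 0 < y by lra.
have -> : divisor_main y - divisor_main M =
  ((y - M) * ln y + M * (ln y - ln M)) + (2 * euler_gamma R - 1) * (y - M).
  by rewrite /divisor_main; ring.
apply: le_trans (ler_normD _ _) _; apply: lerD; last first.
  rewrite normrM ler_piMr// ger0_norm ?subr_ge0//; lra.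
have ly0 : 0 <= ln y by apply: ln_ge0; lra.
have lyM : ln y - ln M = ln (1 + (y - M) / M).
  by rewrite -ln_div ?posrE//; congr ln; field; rewrite gt_eqF.
have w0 : 0 <= (y - M) / M by rewrite divr_ge0 ?subr_ge0// ltW.
have l1 : ln y - ln M <= (y - M) / M by rewrite lyM; apply: le_ln1Dx; lra.
have l0 : 0 <= ln y - ln M by rewrite lyM; apply: ln_ge0; lra.
have l2 : M * (ln y - ln M) <= 1.
  apply: le_trans (ler_wpM2l (ltW M0) l1) _.
  by rewrite mulrCA divff ?gt_eqF// mulr1; lra.
rewrite ger0_norm; last first.
  rewrite addr_ge0// mulr_ge0//; last exact: ltW.
  by rewrite subr_ge0.
by apply: lerD => //; rewrite ler_piMl//; lra.
Qed.

Lemma divisor_delta_le_decay (R : realType) : exists2 C : R, 0 <= C &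
  forall (x : R) (d : nat), 0 < x -> (0 < d)%N ->
  `|(divisor_summatory (Num.truncn x %/ d ^ 2))%:R - divisor_main (x / d%:R ^+ 2)|
    <= C * decay (x / d%:R ^+ 2).
Proof.
set g := `|2 * euler_gamma R - 1|.
have g0 : 0 <= g by exact: normr_ge0.
(* 62 = 58 + 3 + 1: the bound at integers, ln y <= 3 y^(19/40), and the 1 of [divisor_main_diff]. *)
exists (62 + g); first lra.
move=> x d x0 d0; set y := x / d%:R ^+ 2; set M := (_ %/ _)%N.
have d0R : (0 : R) < d%:R ^+ 2 by rewrite exprn_gt0// ltr0n.
have y0 : 0 < y by rewrite divr_gt0.
have /andP[N1 N2] := truncn_itv (ltW x0).
have My : M%:R <= y.
  rewrite ler_pdivlMr// -natrX -natrM; apply: le_trans N1.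
  by rewrite ler_nat leq_divM.
have yM : y < M%:R + 1.
  rewrite natr1 ltr_pdivrMr// -natrX -natrM; apply: lt_le_trans N2 _.
  by rewrite ler_nat ltn_ceil// expn_gt0 d0.
have [M0|M0] := posnP M.
  (* The divisor sum is empty here, and the main term is controlled by y |ln y| <= 4 y^(3/4). *)
  have y1 : y < 1 by move: yM; rewrite M0 add0r.
  have -> : decay y = y `^ (3 / 4).
    by rewrite /decay; apply/min_idPr; apply: ger_powR; rewrite ?y0 ?ltW//; lra.
  rewrite M0 /divisor_summatory big_geq// sub0r normrN /divisor_main.
  apply: le_trans (ler_normD _ _) _; rewrite [leRHS]mulrDl; apply: lerD; last first.
    rewrite normrM -/g gtr0_norm// ler_wpM2l//.
    rewrite -[leLHS]powRr1 ?(ltW y0)//; apply: ger_powR; rewrite ?y0 ?ltW//; lra.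
  rewrite normrM gtr0_norm// ler0_norm; last by apply: ln_le0; exact: ltW.
  rewrite -lnV ?posrE//.
  have yV0 : 0 < y^-1 by rewrite invr_gt0.
  have q0 : (0 : R) < 1 / 4 by lra.
  have := ler_wpM2l (ltW y0) (ln_le_powR q0 yV0).
  have -> : y * ((1 / 4)^-1 * y^-1 `^ (1 / 4)) = 4 * y `^ (3 / 4).
    rewrite -(powR_inv1 (ltW y0)) -powRrM mulN1r.
    rewrite -{1}[y](powRr1 (ltW y0)) mulrCA -powRD; last by rewrite (gt_eqF y0) implybT.
    by congr (_ * _); [field|congr powR; field].
  move=> /le_trans; apply; rewrite ler_wpM2r ?powR_ge0//; lra.
have M1R : (1 : R) <= M%:R by rewrite ler1n.
have y1 : 1 <= y by exact: le_trans My.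
have -> : decay y = y `^ (19 / 40).
  by rewrite /decay; apply/min_idPl; apply: ler_powR => //; lra.
have h1 := divisor_summatory_asymptotic R M0.
have h2 := divisor_main_diff M1R My (ltW yM).
have t0 : (0 : R) < 19 / 40 by lra.
have h3 := ln_le_powR t0 y0.
have h4 : M%:R `^ (19 / 40) <= y `^ (19 / 40).
  by rewrite ge0_ler_powR ?nnegrE ?(ltW y0) ?(ltW t0).
have h5 : 1 <= y `^ (19 / 40) by apply: powR_ge1 => //; exact: ltW.
have -> : (divisor_summatory M)%:R - divisor_main y =
   ((divisor_summatory M)%:R - divisor_main M%:R) - (divisor_main y - divisor_main M%:R) :> R.
  by ring.
apply: le_trans (ler_normB _ _) _.
have h6 : (19 / 40)^-1 * y `^ (19 / 40) <= 3 * y `^ (19 / 40).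
  by rewrite ler_wpM2r ?powR_ge0//; lra.
have h7 : g <= g * y `^ (19 / 40) by rewrite ler_peMr.
rewrite [leRHS]mulrDl; move: h1 h2 h3 h6 h7 h5; rewrite -/g; move: h4.
move: (_ `^ _) (_ `^ _) ((19 / 40)^-1 * _) => *; lra.
Qed.

(** (1 - w)^s <= e^(-s w) <= 1 / (1 + s w) <= 1 - s w / 2, the last because s w <= 1. *)
Lemma powR_1B_le (R : realType) (s w : R) : 0 < s <= 1 -> 0 <= w <= 1 ->
  (1 - w) `^ s <= 1 - s * w / 2.
Proof.
move=> /andP[s0 s1] /andP[w0 w1].
have sw0 : 0 <= s * w by rewrite mulr_ge0// ltW.
have sw1 : s * w <= 1 by rewrite mulr_ile1// ltW.
have [->|wn1] := eqVneq w 1; first by rewrite subrr powR0 ?gt_eqF//; lra.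
have w1' : 0 < 1 - w by rewrite subr_gt0 lt_neqAle wn1.
have h : ln (1 - w) <= - w by apply: le_ln1Dx; lra.
rewrite /powR gt_eqF//; apply: (@le_trans _ _ (expR (- (s * w)))).
  by rewrite ler_expR -mulrN ler_wpM2l// ltW.
rewrite expRN; apply: (@le_trans _ _ (1 + s * w)^-1).
  by rewrite lef_pV2 ?posrE ?expR_gt0 ?expR_ge1Dx//; lra.
by rewrite -[leLHS]mul1r ler_pdivrMr; [nra|lra].
Qed.

Lemma powR_1BV_ge (R : realType) (s w : R) : 0 < s -> 0 <= w < 1 ->
  1 + s * w <= (1 - w) `^ (- s).
Proof.
move=> s0 /andP[w0 w1].
have w1' : 0 < 1 - w by rewrite subr_gt0.
have h : ln (1 - w) <= - w by apply: le_ln1Dx; lra.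
rewrite /powR gt_eqF//; apply: le_trans (expR_ge1Dx _) _.
rewrite ler_expR mulNr -mulrN; apply: ler_wpM2l; first exact: ltW.
by rewrite lerNr.
Qed.

(** Replaces comparison with an integral: sums of n^(s - 1) become telescoping, from y = 1 on. *)
Lemma powR_telescope_le (R : realType) (s y : R) : 0 < s <= 1 -> 1 <= y ->
  y `^ (s - 1) <= 2 / s * (y `^ s - (y - 1) `^ s).
Proof.
move=> s01 y1; have /andP[s0 s1] := s01.
have y0 : 0 < y by apply: lt_le_trans y1.
have w01 : 0 <= y^-1 <= 1 by rewrite invr_ge0 ltW//= invf_le1.
have := powR_1B_le s01 w01.
have -> : (y - 1) `^ s = y `^ s * (1 - y^-1) `^ s.
  rewrite -powRM ?subr_ge0 ?(ltW y0)//; last by case/andP: w01.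
  by rewrite mulrBr mulr1 divff// gt_eqF.
move=> /(ler_wpM2l (powR_ge0 y s)).
rewrite powRB; last by rewrite (gt_eqF y0) implybT.
rewrite powRr1 ?(ltW y0)// => h.
rewrite mulrAC ler_pdivlMr//.
have -> : y `^ s / y * s = 2 * (y `^ s - y `^ s * (1 - s * y^-1 / 2)).
  by field; rewrite gt_eqF.
by rewrite ler_pM2l// lerD2l lerN2.
Qed.

Lemma powRN_telescope_le (R : realType) (s y : R) : 0 < s -> 1 < y ->
  y `^ (- s - 1) <= s^-1 * ((y - 1) `^ (- s) - y `^ (- s)).
Proof.
move=> s0 y1; have y0 : 0 < y by apply: lt_trans y1.
have w01 : 0 <= y^-1 < 1 by rewrite invr_ge0 ltW//= invf_lt1.
have := powR_1BV_ge s0 w01.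
have -> : (y - 1) `^ (- s) = y `^ (- s) * (1 - y^-1) `^ (- s).
  rewrite -powRM ?subr_ge0 ?(ltW y0)//; last by case/andP: w01 => _ /ltW.
  by rewrite mulrBr mulr1 divff// gt_eqF.
move=> /(ler_wpM2l (powR_ge0 y (- s))).
rewrite powRB; last by rewrite (gt_eqF y0) implybT.
rewrite powRr1 ?(ltW y0)// => h.
rewrite [leRHS]mulrC ler_pdivlMr//.
have -> : y `^ (- s) / y * s = y `^ (- s) * (1 + s * y^-1) - y `^ (- s) by ring.
by rewrite lerD2r.
Qed.

Lemma sum_powR_le (R : realType) (s : R) (m : nat) : 0 < s <= 1 ->
  \sum_(1 <= n < m.+1) (n%:R : R) `^ (s - 1) <= 2 / s * m%:R `^ s.
Proof.
move=> s01; have /andP[s0 _] := s01.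
rewrite big_add1 /=.
apply: (@le_trans _ _ (\sum_(0 <= n < m) 2 / s * ((n.+1%:R : R) `^ s - n%:R `^ s))).
  apply: ler_sum_nat => n _.
  have n1 : (1 : R) <= n.+1%:R by rewrite ler1n.
  have <- : n.+1%:R - 1 = n%:R :> R by rewrite -natr1 addrK.
  exact: powR_telescope_le.
by rewrite -mulr_sumr telescope_sumr// powR0 ?gt_eqF// subr0.
Qed.

Lemma sum_powRN_le (R : realType) (s : R) (m P : nat) : 0 < s -> (0 < m < P)%N ->
  \sum_(m.+1 <= n < P) (n%:R : R) `^ (- s - 1) <= s^-1 * m%:R `^ (- s).
Proof.
move=> s0 /andP[m0]; case: P => // P mP; rewrite big_add1 /=.
apply: (@le_trans _ _ (\sum_(m <= n < P) s^-1 * ((n%:R : R) `^ (- s) - n.+1%:R `^ (- s)))).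
  apply: ler_sum_nat => n /andP[mn _].
  have n1 : (1 : R) < n.+1%:R by rewrite ltr1n ltnS (leq_trans m0).
  have <- : n.+1%:R - 1 = n%:R :> R by rewrite -natr1 addrK.
  exact: powRN_telescope_le.
rewrite -mulr_sumr ler_wpM2l ?invr_ge0 ?(ltW s0)//.
under eq_bigr do rewrite -opprB.
by rewrite sumrN telescope_sumr// opprB gerBl powR_ge0.
Qed.

Lemma sum_geometric_le (R : realFieldType) (r : R) (n : nat) : 0 <= r < 1 ->
  \sum_(0 <= k < n) r ^+ k <= (1 - r)^-1.
Proof.
move=> /andP[r0 r1]; rewrite -[leRHS]mul1r ler_pdivlMr ?subr_gt0//.
have -> : (\sum_(0 <= k < n) r ^+ k) * (1 - r) = 1 - r ^+ n.
  elim: n => [|n IH]; first by rewrite big_geq// mul0r expr0 subrr.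
  by rewrite big_nat_recr//= mulrDl IH exprS; ring.
by rewrite gerBl exprn_ge0.
Qed.

(** Dividing the argument by p^2 >= 4 multiplies [decay] by at most 4^(-19/40) < 1, a ratio
    independent of [p]; so all powers of [p] together cost a constant times the first one. *)
Lemma sum_decay_powers_le (R : realType) : exists2 C : R, 0 <= C &
  forall (x : R) (p V : nat), 0 <= x -> (1 < p)%N ->
  \sum_(1 <= nu < V) decay (x / (p ^ nu)%:R ^+ 2) <= C * decay (x / p%:R ^+ 2).
Proof.
pose r : R := 4 `^ (- (19 / 40)).
have r01 : 0 <= r < 1.
  rewrite powR_ge0 /r powRN invf_lt1 ?powR_gt0//.
  have h : 1 `^ (19 / 40) < 4 `^ (19 / 40) :> R.
    by apply: gt0_ltr_powR; rewrite ?nnegrE; lra.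
  by rewrite powR1 in h.
have C0 : 0 <= (1 - r)^-1 by rewrite invr_ge0; case/andP: r01 => _ /ltW; rewrite subr_ge0.
exists (1 - r)^-1 => // x p [|V] x0 p1.
  by rewrite big_geq// mulr_ge0// decay_ge0.
have p0R : (0 : R) < p%:R by rewrite ltr0n ltnW.
rewrite big_add1 /=.
apply: (@le_trans _ _ (\sum_(0 <= k < V) r ^+ k * decay (x / p%:R ^+ 2))); last first.
  by rewrite -mulr_suml ler_wpM2r ?decay_ge0// sum_geometric_le.
apply: ler_sum_nat => k _.
have c1 : 1 <= (p%:R ^+ 2) ^+ k :> R by rewrite exprn_ege1// exprn_ege1// ler1n ltnW.
have -> : x / (p ^ k.+1)%:R ^+ 2 = x / p%:R ^+ 2 / (p%:R ^+ 2) ^+ k.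
  have -> : (p ^ k.+1)%:R ^+ 2 = p%:R ^+ 2 * (p%:R ^+ 2) ^+ k :> R.
    by rewrite natrX -!exprM -exprD; congr (_ ^+ _); lia.
  by rewrite invfM mulrA.
apply: le_trans (decay_div_le _ c1) _; first by rewrite divr_ge0// exprn_ge0// ltW.
rewrite ler_wpM2r ?decay_ge0//.
have powRXn (a c : R) : 0 <= a -> (a ^+ k) `^ c = (a `^ c) ^+ k.
  by move=> a0; rewrite -(powR_mulrn k a0) -powRrM mulrC powRrM powR_mulrn ?powR_ge0.
rewrite powRXn ?exprn_ge0 ?(ltW p0R)//.
apply: lerXn2r; rewrite ?nnegrE ?powR_ge0//.
rewrite /r !powRN lef_pV2 ?posrE ?powR_gt0 ?exprn_gt0//.
apply: ge0_ler_powR; rewrite ?nnegrE ?exprn_ge0 ?(ltW p0R)//.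
by rewrite -natrX ler_nat (@leq_exp2r 2 p 2).
Qed.

Lemma sum_ln_decay_le (R : realType) (eta : R) : 0 <= eta ->
  exists2 C : R, 0 <= C & forall (x : R) (P : nat), 1 <= x -> 1 <= ln x ->
    (Num.truncn x < P)%N ->
    \sum_(1 <= n < P) ln n%:R `^ eta * decay (x / n%:R ^+ 2)
      <= C * (x `^ 2^-1 * ln x `^ eta).
Proof.
move=> eta0; have [K K0 HK] := exists_ln1D_powR_le eta0.
exists (40 + 8 * K); first by rewrite addr_ge0 ?mulr_ge0.
move=> x P x1 lx1 NP; have x0 : 0 < x by apply: lt_le_trans x1.
set z := x `^ 2^-1.
have z0 : 0 < z by exact: powR_gt0.
have z1 : 1 <= z by apply: powR_ge1.
have xE : x = z ^+ 2.
  rewrite -powR_mulrn ?(ltW z0)// /z -powRrM mulVf ?powRr1//; exact: ltW.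
have zx : z <= x by rewrite xE expr2 ler_peMl// ltW.
clearbody z.
pose m := Num.truncn z.
have /andP[mz zm] := truncn_itv (ltW z0); rewrite -/m in mz zm.
have m0 : (0 < m)%N by rewrite truncn_gt0.
have mP : (m < P)%N by apply: leq_ltn_trans NP; exact: le_truncn.
have decayE (n : nat) : (0 < n)%N -> decay (x / n%:R ^+ 2) =
    Num.min (z `^ (19 / 20) * n%:R `^ (1 / 20 - 1)) (z `^ (3 / 2) * n%:R `^ (- (3 / 2))).
  move=> n0; have n0R : (0 : R) < n%:R by rewrite ltr0n.
  have E (s : R) : (x / n%:R ^+ 2) `^ s = z `^ (2%:R * s) * n%:R `^ (- (2%:R * s)).
    rewrite xE -expr_div_n -powR_mulrn; last by rewrite divr_ge0// ltW.
    rewrite -powRrM powRM ?invr_ge0 ?(ltW z0) ?(ltW n0R)//.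
    by rewrite -[n%:R^-1]powR_inv1 ?(ltW n0R)// -powRrM mulN1r.
  by rewrite /decay !E; congr (Num.min (_ `^ _ * _ `^ _) (_ `^ _ * _ `^ _)); field.
have L0 : 0 <= ln x `^ eta by exact: powR_ge0.
rewrite (@big_cat_nat _ _ _ m.+1)//=.
have -> : (40 + 8 * K) * (z * ln x `^ eta) =
    40 * (ln x `^ eta * z) + 8 * (ln x `^ eta * K * z) by ring.
apply: lerD.
  (* Up to [m] the first power of the envelope is used, with ln n <= ln x. *)
  apply: (@le_trans _ _ (\sum_(1 <= n < m.+1) ln x `^ eta * z `^ (19 / 20) * n%:R `^ (1 / 20 - 1))).
    apply: ler_sum_nat => n /andP[n0 nm].
    have n1R : (1 : R) <= n%:R by rewrite ler1n.
    have n0R : (0 : R) < n%:R by rewrite ltr0n.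
    have nx : n%:R <= x by apply: le_trans zx; apply: le_trans mz; rewrite ler_nat.
    rewrite -mulrA ler_pM ?powR_ge0 ?decay_ge0//; last by rewrite decayE// ge_min lexx.
    apply: ge0_ler_powR; rewrite ?nnegrE ?ln_ge0//.
    by rewrite ler_ln.
  have s01 : (0 < 1 / 20 :> R) && (1 / 20 <= 1 :> R) by apply/andP; split; lra.
  rewrite -mulr_sumr; apply: le_trans (ler_wpM2l _ (sum_powR_le m s01)) _.
    by rewrite mulr_ge0// powR_ge0.
  have h : m%:R `^ (1 / 20) <= z `^ (1 / 20) :> R.
    by apply: ge0_ler_powR; rewrite ?nnegrE ?(ltW z0).
  have zE : z = z `^ (19 / 20) * z `^ (1 / 20).
    rewrite -powRD; last by rewrite (gt_eqF z0) implybT.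
    have -> : 19 / 20 + 1 / 20 = 1 :> R by field.
    by rewrite powRr1// ltW.
  have -> : 2 / (1 / 20) = 40 :> R by field.
  rewrite [in leRHS]zE.
  have := ler_wpM2l (mulr_ge0 L0 (powR_ge0 z (19 / 20))) h.
  lra.
apply: (@le_trans _ _ (\sum_(m.+1 <= n < P)
    ln x `^ eta * K * z `^ (5 / 4) * n%:R `^ (- (1 / 4) - 1))).
  apply: ler_sum_nat => n /andP[mn _].
  have n0 : (0 < n)%N by apply: leq_ltn_trans mn.
  have n0R : (0 : R) < n%:R by rewrite ltr0n.
  have zn : z <= n%:R by apply: le_trans (ltW zm) _; rewrite ler_nat.
  have u1 : 1 <= n%:R / z by rewrite ler_pdivlMr// mul1r.
  have lu0 : 0 <= ln (n%:R / z) by exact: ln_ge0.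
  (* In the tail ln n is not bounded by ln x. As ln z <= ln x and 1 <= ln x, the excess is a factor
     in n / z alone, paid for by (n / z)^(1/4). *)
  have lnn : ln n%:R <= ln x * (1 + ln (n%:R / z)).
    have -> : ln n%:R = ln z + ln (n%:R / z) by rewrite ln_div ?posrE//; ring.
    have : ln z <= ln x by rewrite ler_ln.
    by rewrite mulrDr mulr1 => ?; rewrite lerD// ler_peMl.
  have h1 : ln n%:R `^ eta <= ln x `^ eta * (K * (n%:R / z) `^ (1 / 4)).
    apply: (@le_trans _ _ ((ln x * (1 + ln (n%:R / z))) `^ eta)).
      apply: ge0_ler_powR; rewrite ?nnegrE//; first by rewrite ln_ge0// ler1n.
      by rewrite mulr_ge0// ?addr_ge0//; lra.
    rewrite powRM ?addr_ge0//; last lra.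
    by rewrite ler_wpM2l// HK.
  have h2 : decay (x / n%:R ^+ 2) <= z `^ (3 / 2) * n%:R `^ (- (3 / 2)).
    by rewrite decayE// ge_min lexx orbT.
  apply: le_trans (ler_pM (powR_ge0 _ _) (decay_ge0 _) h1 h2) _.
  have -> : (n%:R / z) `^ (1 / 4) = n%:R `^ (1 / 4) * z `^ (- (1 / 4)).
    rewrite powRM ?invr_ge0 ?(ltW z0) ?(ltW n0R)//.
    by rewrite -[z^-1]powR_inv1 ?(ltW z0)// -powRrM mulN1r.
  have -> : z `^ (5 / 4) = z `^ (- (1 / 4)) * z `^ (3 / 2).
    rewrite -powRD; last by rewrite (gt_eqF z0) implybT.
    by congr powR; field.
  have -> : n%:R `^ (- (1 / 4) - 1) = n%:R `^ (1 / 4) * n%:R `^ (- (3 / 2)) :> R.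
    rewrite -powRD; last by rewrite (gt_eqF n0R) implybT.
    by congr powR; field.
  by rewrite le_eqVlt; apply/orP; left; apply/eqP; ring.
have s0 : (0 : R) < 1 / 4 by lra.
have mm : (0 < m < P)%N by rewrite m0.
rewrite -mulr_sumr; apply: le_trans (ler_wpM2l _ (sum_powRN_le s0 mm)) _.
  by rewrite !mulr_ge0// ?powR_ge0.
(* z < m + 1 <= 2 m. *)
have h : m%:R `^ (- (1 / 4)) <= 2 * z `^ (- (1 / 4)).
  rewrite !powRN ler_pdivlMr ?powR_gt0// mulrC ler_pdivrMr ?powR_gt0 ?ltr0n//.
  apply: (@le_trans _ _ ((2 * m%:R) `^ (1 / 4))).
    apply: ge0_ler_powR; rewrite ?nnegrE ?(ltW z0)//.
    apply: le_trans (ltW zm) _; rewrite -natrM ler_nat mul2n -addnn -addn1.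
    by rewrite leq_add2l.
  rewrite powRM// ler_wpM2r ?powR_ge0//.
  by apply: ler1_powR; lra.
have zE : z = z `^ (5 / 4) * z `^ (- (1 / 4)).
  rewrite -powRD; last by rewrite (gt_eqF z0) implybT.
  have -> : 5 / 4 - 1 / 4 = 1 :> R by field.
  by rewrite powRr1// ltW.
have -> : (1 / 4)^-1 = 4 :> R by field.
rewrite [in leRHS]zE.
have := ler_wpM2l (mulr_ge0 (mulr_ge0 L0 K0) (powR_ge0 z (5 / 4))) h.
lra.
Qed.

(** * Complex series *)

(** The norm of [R[i]] has values in [R[i]]; this is the same modulus in [R], where the real
    estimates and limits apply. *)
Definition cmod (R : rcfType) (z : R[i]) : R := complex.Re `|z|.

Lemma normc_cmod (R : rcfType) (z : R[i]) : `|z| = (cmod z)%:C.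
Proof. by rewrite /cmod normc_def. Qed.

Lemma cmod_ge0 (R : rcfType) (z : R[i]) : 0 <= cmod z.
Proof. by rewrite -lecR -normc_cmod rmorph0 normr_ge0. Qed.

Lemma cmodM (R : rcfType) (z w : R[i]) : cmod (z * w) = cmod z * cmod w.
Proof.
by have := normrM z w; rewrite !normc_cmod -rmorphM => /(congr1 (@complex.Re R)).
Qed.

Lemma cmod_real (R : rcfType) (a : R) : cmod a%:C = `|a|.
Proof. by rewrite /cmod normc_def /= expr0n addr0 sqrtr_sqr. Qed.

Lemma ler_cmod_sum (R : rcfType) (I : Type) (r : seq I) (P : pred I) (F : I -> R[i]) :
  cmod (\sum_(i <- r | P i) F i) <= \sum_(i <- r | P i) cmod (F i).
Proof.
rewrite -lecR -normc_cmod rmorph_sum /=.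
by under [leRHS]eq_bigr do rewrite -normc_cmod; exact: ler_norm_sum.
Qed.

Lemma cmod_ge_Re (R : rcfType) (z : R[i]) : `|complex.Re z| <= cmod z.
Proof. by rewrite -lecR -normc_cmod normc_ge_Re. Qed.

Lemma cmod_ge_Im (R : rcfType) (z : R[i]) : `|complex.Im z| <= cmod z.
Proof.
by rewrite /cmod normc_def /= -sqrtr_sqr ler_wsqrtr// lerDr sqr_ge0.
Qed.

Lemma cmod_le_ReIm (R : rcfType) (z : R[i]) :
  cmod z <= `|complex.Re z| + `|complex.Im z|.
Proof.
rewrite /cmod normc_def /=.
have h : 0 <= `|complex.Re z| + `|complex.Im z| by rewrite addr_ge0.
rewrite -[leRHS](ger0_norm h) -[leRHS]sqrtr_sqr ler_wsqrtr//.
rewrite sqrrD !real_normK ?num_real//.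
by rewrite -addrA [_ *+ 2 + _]addrC addrA lerDl mulrn_wge0// mulr_ge0.
Qed.

Lemma cvg_complex (R : realType) (u : nat -> R[i]) (a b : R) :
  (fun n => complex.Re (u n)) @ \oo --> a -> (fun n => complex.Im (u n)) @ \oo --> b ->
  (u : nat -> R[i]^o) @ \oo --> (a +i* b : R[i]^o).
Proof.
move=> ua ub; apply/cvgrPdist_lt => eps eps0.
have [e e0 ->] : exists2 e : R, 0 < e & eps = e%:C.
  move: eps0; case: eps => e1 e2; rewrite ltcE /= => /andP[/eqP e20 e10].
  by exists e1 => //; rewrite e20.
have e20 : 0 < e / 2 by rewrite divr_gt0.
move/cvgrPdist_lt : ua => /(_ _ e20) ua; move/cvgrPdist_lt : ub => /(_ _ e20) ub.
near=> n.
rewrite [X in X < _]normc_cmod ltcR; apply: le_lt_trans (cmod_le_ReIm _) _.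
have -> : complex.Re ((a +i* b) - u n) = a - complex.Re (u n) by case: (u n).
have -> : complex.Im ((a +i* b) - u n) = b - complex.Im (u n) by case: (u n).
rewrite (splitr e); apply: ltrD; near: n; [exact: ua|exact: ub].
Unshelve. all: by end_near. Qed.

(** Absolute convergence, reduced to real series through real and imaginary parts. *)
Lemma cvg_complex_series (R : realType) (P : pred nat) (u : nat -> R[i]) (B : R) :
  (forall n, \sum_(0 <= k < n | P k) cmod (u k) <= B) ->
  cvgn (fun n => \sum_(0 <= k < n | P k) (u k : R[i]^o)).
Proof.
move=> uB.
have real_part (phi : R[i] -> R) :
    (forall z, `|phi z| <= cmod z) -> cvgn (fun n => \sum_(0 <= k < n | P k) phi (u k)).
  move=> phile.
  pose v k := if P k then phi (u k) else 0.
  have -> : (fun n => \sum_(0 <= k < n | P k) phi (u k)) = series v.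
    by apply/funext => n; rewrite /series /= [LHS]big_mkcond.
  have key : cvgn (series (fun k => `|v k|)).
    apply: nondecreasing_is_cvgn.
      by apply/nondecreasing_seqP => n; rewrite seriesSr lerDl.
    exists B => _ [n _ <-]; apply: le_trans (uB n); rewrite /series /= [leRHS]big_mkcond.
    by apply: ler_sum => k _; rewrite /v; case: ifP => // _; rewrite normr0.
  exact: normed_cvg.
have reC := real_part _ (@cmod_ge_Re R); have imC := real_part _ (@cmod_ge_Im R).
apply: (cvgP (limn (fun n => \sum_(0 <= k < n | P k) complex.Re (u k)) +i*
        limn (fun n => \sum_(0 <= k < n | P k) complex.Im (u k)) : R[i]^o)).
apply: cvg_complex.
  have -> : (fun n => complex.Re (\sum_(0 <= k < n | P k) u k)) =
     (fun n => \sum_(0 <= k < n | P k) complex.Re (u k)).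
    by apply/funext => n; rewrite raddf_sum.
  exact: reC.
have -> : (fun n => complex.Im (\sum_(0 <= k < n | P k) u k)) =
   (fun n => \sum_(0 <= k < n | P k) complex.Im (u k)).
  by apply/funext => n; rewrite raddf_sum.
exact: imC.
Qed.

Lemma norm_cvg_le (R : realType) (u : nat -> R[i]) (l : R[i]) (N : nat) (B : R) :
  (u : nat -> R[i]^o) @ \oo --> (l : R[i]^o) ->
  (forall n, (N <= n)%N -> cmod (u n) <= B) -> `|l| <= B%:C.
Proof.
move=> ul uB; rewrite normc_cmod lecR; apply/ler_addgt0Pr => e e0.
have e0C : (0 : R[i]) < e%:C by rewrite ltcR.
move/cvgrPdist_lt : ul => /(_ _ e0C) [M _ HM].
have := HM (maxn M N) (leq_maxl _ _); rewrite /= [X in X < _]normc_cmod ltcR => h.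
have := uB (maxn M N) (leq_maxr _ _) => h2.
have : cmod l <= cmod (l - u (maxn M N)) + cmod (u (maxn M N)).
  rewrite -lecR rmorphD /= -!normc_cmod -{1}[l](subrK (u (maxn M N))).
  exact: ler_normD.
by move=> /le_trans; apply; rewrite addrC lerD// ltW.
Qed.

(** The weight 2^nu dominates 1 and nu, so the inner series of C_f and of D_f are treated together.
    For nu >= 1 the terms are at most (4 / p^2) 2^(-nu), because p^2 >= 4. *)
Lemma weighted_prime_power_series (R : realType) (S : set nat) (w : nat -> R) (p : nat) :
  (forall nu, S nu -> (0 < nu)%N) -> (1 < p)%N ->
  (forall nu, 0 <= w nu <= 2 ^+ nu / p%:R ^+ (2 * nu)) ->
  cvgn (fun V => \sum_(0 <= nu < V | nu \in S) w nu) /\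
  0 <= \big[+%R/0]_(0 <= nu <oo | nu \in S) w nu <= 8 / p%:R ^+ 2.
Proof.
move=> hS p1 hw; set u := fun V => _.
have p0R : (0 : R) < p%:R by rewrite ltr0n ltnW.
have term0 nu : 0 <= w nu by case/andP: (hw nu).
have u_nd : nondecreasing_seq u.
  apply/nondecreasing_seqP => n; rewrite /u big_mkcond [leRHS]big_mkcond big_nat_recr//=.
  by rewrite lerDl; case: ifP.
have ub V : u V <= 8 / p%:R ^+ 2.
  rewrite /u big_mkcond /=.
  apply: (@le_trans _ _ (\sum_(0 <= nu < V) 4 / p%:R ^+ 2 * 2^-1 ^+ nu)).
    apply: ler_sum_nat => -[|nu] _.
      case: ifP => [/set_mem/hS//|_].
      by rewrite expr0 mulr1 divr_ge0// exprn_ge0// ltW.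
    case: ifP => _; last by rewrite mulr_ge0 ?divr_ge0 ?exprn_ge0// ltW.
    have /andP[_ h] := hw nu.+1.
    apply: le_trans h _; rewrite mulnS exprD invfM mulrCA [leRHS]mulrAC [leRHS]mulrC.
    rewrite ler_wpM2l ?invr_ge0 ?exprn_ge0 ?(ltW p0R)//.
    rewrite ler_pdivrMr ?exprn_gt0//.
    have -> : 4 * 2^-1 ^+ nu.+1 * p%:R ^+ (2 * nu) =
        2 ^+ nu.+1 * (p%:R ^+ (2 * nu) / (2 ^+ 2) ^+ nu) :> R.
      have a0 : 2 ^+ nu != 0 :> R by rewrite expf_neq0.
      rewrite exprVn !exprS expr0 mulr1 [in RHS]exprMn.
      by move: (2 ^+ nu) a0 (p%:R ^+ _) => a a0 b; field.
    rewrite ler_peMr ?exprn_ge0// ler_pdivlMr ?exprn_gt0// mul1r exprM.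
    by apply: lerXn2r; rewrite ?nnegrE ?exprn_ge0// -!natrX ler_nat (@leq_exp2r 2 p 2).
  rewrite -mulr_sumr (_ : 8 / _ = 4 / p%:R ^+ 2 * 2); last by ring.
  have h2 : (0 <= 2^-1 :> R) && (2^-1 < 1 :> R) by apply/andP; split; lra.
  rewrite ler_wpM2l ?divr_ge0 ?exprn_ge0 ?(ltW p0R)//.
  have two : (1 - 2^-1)^-1 = 2 :> R by field.
  by rewrite -[leRHS]two sum_geometric_le.
have u_cvg : cvgn u by apply: nondecreasing_is_cvgn => //; exists (8 / p%:R ^+ 2) => _ [V _ <-].
split=> //; apply/andP; split.
  apply: limr_ge => //; near=> V; exact: sumr_ge0.
by apply: limr_le => //; near=> V.
Unshelve. all: by end_near. Qed.

(** * The asymptotic formula *)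

Lemma normr_cvg_le (R : realType) (u : nat -> R) (l B : R) (N : nat) :
  u @ \oo --> l -> (forall n, (N <= n)%N -> `|u n| <= B) -> `|l| <= B.
Proof.
move=> ul uB; have lE := cvg_lim (@Rhausdorff R) ul.
have cu : cvgn u by exact: cvgP ul.
rewrite ler_norml -lE; apply/andP; split.
  by apply: limr_ge => //; exists N => // n /= /uB; rewrite ler_norml => /andP[].
by apply: limr_le => //; exists N => // n /= /uB; rewrite ler_norml => /andP[].
Qed.

Lemma cvg_affine_combination (K : numFieldType) (V : normedModType K) (u v : nat -> V)
    (w l m : V) (a b : K) :
  u @ \oo --> l -> v @ \oo --> m ->
  (fun n => w - (a *: u n - b *: v n)) @ \oo --> w - (a *: l - b *: m).
Proof.
move=> ul vm; apply: cvgB; first exact: cvg_cst.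
by apply: cvgB; apply: cvgZr.
Qed.

(** The finitely many small primes are absorbed by adding their quotients |g(p)| / (log p)^eta to
    the constant; log p > 0 makes them legitimate. *)
Lemma exists_uniform_log_bound (R : realType) (Q : set nat) (g : nat -> R[i]) (eta : R) :
  (forall p, Q p -> prime p) ->
  (exists K : R, \forall p \near \oo, Q p -> `|g p| <= (K * ln p%:R `^ eta)%:C) ->
  exists2 K : R, 0 <= K & forall p, Q p -> cmod (g p) <= K * ln p%:R `^ eta.
Proof.
move=> hQ [K [N _ HK]].
pose M := \sum_(0 <= p < N) cmod (g p) / ln p%:R `^ eta.
have M0 : 0 <= M by apply: sumr_ge0 => p _; rewrite divr_ge0 ?cmod_ge0 ?powR_ge0.
exists (`|K| + M); first by rewrite addr_ge0.
move=> p Qp; have p1 := prime_gt1 (hQ p Qp).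
have l0 : 0 < ln p%:R `^ eta :> R by rewrite powR_gt0// ln_gt0// ltr1n.
have [Np|pN] := leqP N p.
  have := HK p Np Qp; rewrite normc_cmod lecR => /le_trans; apply.
  by rewrite ler_wpM2r ?(ltW l0)// (le_trans (ler_norm K))// lerDl.
rewrite -ler_pdivrMr// (le_trans _ (_ : M <= _)) ?lerDr//.
rewrite /M (bigD1_seq p) ?iota_uniq//= ?mem_index_iota// lerDl.
by apply: sumr_ge0 => q _; rewrite divr_ge0 ?cmod_ge0 ?powR_ge0.
Qed.

Definition inv_power_sum (R : realType) (S : set nat) (p : nat) : R :=
  \big[+%R/0]_(0 <= nu <oo | nu \in S) ((p%:R ^+ (2 * nu))^-1 : R).

Definition exponent_power_sum (R : realType) (S : set nat) (p : nat) : R :=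
  \big[+%R/0]_(0 <= nu <oo | nu \in S) (nu%:R / p%:R ^+ (2 * nu) : R).

Lemma inv_power_sumP (R : realType) (S : set nat) (p : nat) :
  (forall nu, S nu -> (0 < nu)%N) -> (1 < p)%N ->
  cvgn (fun V => \sum_(0 <= nu < V | nu \in S) ((p%:R ^+ (2 * nu))^-1 : R)) /\
  0 <= inv_power_sum R S p <= 8 / p%:R ^+ 2.
Proof.
move=> hS p1; apply: weighted_prime_power_series => // nu.
have p0 : (0 : R) < (p%:R ^+ (2 * nu))^-1 by rewrite invr_gt0 exprn_gt0// ltr0n ltnW.
rewrite (ltW p0) /= ler_peMl ?(ltW p0)// -natrX ler1n expn_gt0//.
Qed.

Lemma exponent_power_sumP (R : realType) (S : set nat) (p : nat) :
  (forall nu, S nu -> (0 < nu)%N) -> (1 < p)%N ->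
  cvgn (fun V => \sum_(0 <= nu < V | nu \in S) (nu%:R / p%:R ^+ (2 * nu) : R)) /\
  0 <= exponent_power_sum R S p <= 8 / p%:R ^+ 2.
Proof.
move=> hS p1; apply: weighted_prime_power_series => // nu.
have p0 : (0 : R) < (p%:R ^+ (2 * nu))^-1 by rewrite invr_gt0 exprn_gt0// ltr0n ltnW.
by rewrite mulr_ge0 ?(ltW p0)//= ler_wpM2r ?(ltW p0)// -natrX ler_nat ltnW// ltn_expl.
Qed.

(** The difference is the sum of Delta(x / p^(2 nu)) over all [nu] in [S], including those with p^(2
    nu) > x. It is bounded for partial sums and carried to the limit. *)
Lemma prime_remainder_le (R : realType) (S : set nat) :
  (forall nu, S nu -> (0 < nu)%N) ->
  exists2 C : R, 0 <= C & forall (x : R) (p : nat), 0 < x -> (1 < p)%N ->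
  `|\sum_(0 <= nu < (Num.truncn x).+1 | nu \in S)
        (divisor_summatory (Num.truncn x %/ (p ^ nu) ^ 2))%:R
    - x * ((ln x + (2 * euler_gamma R - 1)) * inv_power_sum R S p
           - 2 * ln p%:R * exponent_power_sum R S p)| <= C * decay (x / p%:R ^+ 2).
Proof.
move=> hS; have [C1 C10 HC1] := divisor_delta_le_decay R.
have [C2 C20 HC2] := sum_decay_powers_le R.
exists (C1 * C2); first exact: mulr_ge0.
move=> x p x0 p1; set N := Num.truncn x; set T := \sum_(_ <= _ < _ | _) _.
have p0 : (0 < p)%N by exact: ltnW.
have p0R : (0 : R) < p%:R by rewrite ltr0n.
set A := ln x + _.
pose sV V : R := \sum_(0 <= nu < V | nu \in S) (p%:R ^+ (2 * nu))^-1.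
pose tV V : R := \sum_(0 <= nu < V | nu \in S) nu%:R / p%:R ^+ (2 * nu).
have [s_cvg _] := inv_power_sumP R hS p1; have [t_cvg _] := exponent_power_sumP R hS p1.
apply: (@normr_cvg_le R (fun V => T - x * (A * sV V - 2 * ln p%:R * tV V)) _ _ N.+1).
  apply: cvgB; first exact: cvg_cst.
  apply: cvgM; first exact: cvg_cst.
  by apply: cvgB; (apply: cvgM; first exact: cvg_cst).
move=> V NV.
have -> : T - x * (A * sV V - 2 * ln p%:R * tV V) = \sum_(0 <= nu < V | nu \in S)
    ((divisor_summatory (N %/ (p ^ nu) ^ 2))%:R - divisor_main (x / (p ^ nu)%:R ^+ 2)).
  rewrite sumrB; congr (_ - _).
    (* For nu > N the power p^(2 nu) exceeds N, so these divisor sums are 0. *)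
    rewrite [RHS](@big_cat_nat _ _ _ N.+1)//= [X in _ + X]big_nat_cond.
    rewrite [X in _ + X]big1 ?addr0// => nu /andP[/andP[Nnu _] _].
    rewrite divn_small ?/divisor_summatory ?big_geq//.
    rewrite (leq_trans Nnu)// (leq_trans (ltnW (ltn_expl nu p1)))//.
    by rewrite -mulnn leq_pmulr// expn_gt0 p0.
  rewrite mulrBr !mulr_sumr -sumrB; apply: eq_bigr => nu _.
  have q0 : (0 : R) < p%:R ^+ (2 * nu) by rewrite exprn_gt0.
  have -> : (p ^ nu)%:R ^+ 2 = p%:R ^+ (2 * nu) :> R by rewrite natrX -exprM mulnC.
  (* ln(x / p^(2 nu)) = ln x - 2 nu ln p separates the two inner series. *)
  rewrite /divisor_main ln_div ?posrE// lnXn// -[ln p%:R *+ _]mulr_natl natrM /A.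
  by field; rewrite gt_eqF.
apply: le_trans (ler_norm_sum _ _ _) _.
apply: (@le_trans _ _ (\sum_(1 <= nu < V) C1 * decay (x / (p ^ nu)%:R ^+ 2))).
  case: V NV => // V _.
  rewrite big_mkcond big_ltn//= ifF ?add0r; last first.
    by apply/negP => /set_mem/hS.
  apply: ler_sum_nat => nu _; case: ifP => _.
    by apply: HC1 => //; rewrite expn_gt0 p0.
  by rewrite mulr_ge0// decay_ge0.
rewrite -mulr_sumr -mulrA ler_wpM2l//; apply: HC2 => //; exact: ltW.
Qed.

(** The factor 2 p^(1/2) majorizes both weights, 1 in C_f and ln p in D_f. With (ln p)^eta =
    O(p^(1/4)) the terms are O(p^(-5/4)). *)
Lemma prime_series_cvg (R : realType) (Q : set nat) (K eta : R) (F : nat -> R[i]) :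
  0 <= K -> 0 <= eta -> (forall p, Q p -> prime p) ->
  (forall p, Q p -> cmod (F p) <= K * ln p%:R `^ eta * (2 * p%:R `^ 2^-1) / p%:R ^+ 2) ->
  cvgn (fun P => \sum_(0 <= p < P | p \in Q) (F p : R[i]^o)).
Proof.
move=> K0 eta0 hQ hF; have [L L0 HL] := exists_ln1D_powR_le eta0.
have KL0 : 0 <= 2 * K * L by rewrite !mulr_ge0.
apply: (@cvg_complex_series R (fun p => p \in Q) F (2 * K * L * 5)) => -[|P].
  by rewrite big_geq// mulr_ge0.
have s0 : (0 : R) < 1 / 4 by lra.
apply: (@le_trans _ _ (\sum_(1 <= p < P.+1) 2 * K * L * p%:R `^ (- (1 / 4) - 1))); last first.
  rewrite -mulr_sumr ler_wpM2l//; case: P => [|P]; first by rewrite big_geq.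
  rewrite big_ltn// powR1.
  have := sum_powRN_le (m := 1) (P := P.+2) s0 isT; rewrite powR1 mulr1.
  have -> : (1 / 4)^-1 = 4 :> R by field.
  lra.
rewrite big_mkcond big_ltn//= ifF ?add0r; last by apply/negP => /set_mem/hQ.
apply: ler_sum_nat => p _; case: ifP => [/set_mem Qp|_]; last first.
  by rewrite mulr_ge0// powR_ge0.
have p1 := prime_gt1 (hQ p Qp).
have p1R : (1 : R) <= p%:R by rewrite ler1n ltnW.
have p0R : (0 : R) < p%:R by apply: lt_le_trans p1R.
have l0 : (0 : R) <= ln p%:R by exact: ln_ge0.
have h : ln p%:R `^ eta <= L * p%:R `^ (1 / 4) :> R.
  apply: le_trans (HL _ p1R).
  by apply: ge0_ler_powR; rewrite ?nnegrE ?addr_ge0// lerDr.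
apply: le_trans (hF p Qp) _.
have -> : p%:R `^ (- (1 / 4) - 1) = p%:R `^ (1 / 4) * p%:R `^ 2^-1 / p%:R ^+ 2 :> R.
  rewrite -(powR_invn 2 (ltW p0R)) -!powRD ?(gt_eqF p0R) ?implybT//.
  by congr powR; field.
have c0 : 0 <= 2 * K * p%:R `^ 2^-1 / p%:R ^+ 2 :> R.
  by rewrite divr_ge0 ?exprn_ge0 ?mulr_ge0 ?powR_ge0.
have := ler_wpM2l c0 h.
set a := ln _ `^ _; set b := _ `^ (1 / 4); set c := _ `^ 2^-1; set d := (_ ^+ 2)^-1.
have -> : 2 * K * c * d * a = K * a * (2 * c) * d by ring.
by have -> : 2 * K * c * d * (L * b) = 2 * K * L * (b * c * d) by ring.
Qed.

Theorem theorem3 (R : realType) (f : nat -> R[i]) (Q S : set nat)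
    (g : nat -> R[i]) (eta : R)
    (hQ : forall p, Q p -> prime p)
    (hS : forall nu, S nu -> (0 < nu)%N)
    (hS1 : S 1%N)
    (hi : forall n : nat, (0 < n)%N ->
       ~ (exists p nu, [/\ Q p, S nu & n = (p ^ nu)%N]) ->
       dirichlet_conv (fun d => (mobius d)%:~R) f n = 0)
    (hii : forall p nu, Q p -> S nu ->
       dirichlet_conv (fun d => (mobius d)%:~R) f (p ^ nu)%N = g p)
    (heta : 0 <= eta)
    (hiii : exists K : R, \forall p \near \oo,
       Q p -> `|g p| <= (K * ln p%:R `^ eta)%:C) :
  exists K : R, \forall x \near (+oo : set_system R),
    `|gcd_sum f x - x%:C * (const_C Q S g * (ln x)%:C + const_D Q S g)|
      <= (K * (x `^ 2^-1 * ln x `^ eta))%:C.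
Proof.
have [K1 K10 HK1] := exists_uniform_log_bound hQ hiii.
have [C2 C20 HC2] := prime_remainder_le R hS.
have [C3 C30 HC3] := sum_ln_decay_le heta.
pose s := inv_power_sum R S; pose t := exponent_power_sum R S.
pose F p : R[i] := g p * (s p)%:C.
pose G p : R[i] := g p * (ln (p%:R : R))%:C * (t p)%:C.
have term_le p (w y : R) : Q p -> 0 <= w <= 2^-1 * p%:R `^ 2^-1 * 4 ->
    0 <= y <= 8 / p%:R ^+ 2 -> cmod (g p) * w * y <=
    8 * K1 * ln p%:R `^ eta * (2 * p%:R `^ 2^-1) / p%:R ^+ 2.
  move=> Qp /andP[w0 w1] /andP[y0 y1].
  have := ler_pM (mulr_ge0 (cmod_ge0 (g p)) w0) y0 (ler_pM (cmod_ge0 _) w0 (HK1 p Qp) w1) y1.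
  move=> /le_trans; apply; rewrite le_eqVlt; apply/orP; left; apply/eqP.
  by move: (_ `^ _) (_ `^ _) (_ ^+ 2)^-1 => a b c; field.
have sqrt_ge1 p : Q p -> 1 <= p%:R `^ 2^-1 :> R.
  by move=> Qp; rewrite powR_ge1// ler1n prime_gt0//; exact: hQ.
have K80 : 0 <= 8 * K1 by rewrite mulr_ge0.
have F_cvg : cvgn (fun P => \sum_(0 <= p < P | p \in Q) (F p : R[i]^o)).
  apply: (prime_series_cvg K80 heta hQ) => p Qp.
  have p1 := prime_gt1 (hQ p Qp); have [_ sp] := inv_power_sumP R hS p1.
  have /andP[s0 _] := sp.
  rewrite /F cmodM cmod_real ger0_norm// -[cmod (g p)]mulr1; apply: term_le => //.
  by rewrite ler01 /=; have := sqrt_ge1 p Qp; lra.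
have G_cvg : cvgn (fun P => \sum_(0 <= p < P | p \in Q) (G p : R[i]^o)).
  apply: (prime_series_cvg K80 heta hQ) => p Qp.
  have p1 := prime_gt1 (hQ p Qp); have [_ tp] := exponent_power_sumP R hS p1.
  have /andP[t0 _] := tp.
  have p0R : (0 : R) < p%:R by rewrite ltr0n ltnW.
  have l0 : (0 : R) <= ln p%:R by rewrite ln_ge0// ler1n ltnW.
  rewrite /G !cmodM !cmod_real !ger0_norm//; apply: term_le => //.
  rewrite l0 /=; have h2 : (0 : R) < 2^-1 by rewrite invr_gt0.
  have := ln_le_powR h2 p0R; rewrite invrK; lra.
exists (K1 * C2 * C3); near=> x.
have xe : expR 1 <= x by near: x; exact: nbhs_pinfty_ge.
have x1 : 1 <= x by apply: le_trans xe; rewrite -[leLHS](expR0 R) ler_expR.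
have x0 : 0 < x by apply: lt_le_trans x1.
have lx1 : 1 <= ln x by rewrite -[leLHS](expRK 1) ler_ln ?posrE ?expR_gt0.
set N := Num.truncn x.
pose T p : R := \sum_(0 <= nu < N.+1 | nu \in S)
  (divisor_summatory (N %/ (p ^ nu) ^ 2))%:R.
pose rem p : R := T p - x * ((ln x + (2 * euler_gamma R - 1)) * s p - 2 * ln p%:R * t p).
have gcdE P : (N < P)%N -> gcd_sum f x = \sum_(0 <= p < P | p \in Q) g p * (T p)%:C.
  move=> NP; rewrite (gcd_sum_divisor_summatory _ (ltW x0)) -/N.
  rewrite (@sum_prime_power_support _ _ g
    (fun d => (divisor_summatory (N %/ d ^ 2))%:R) Q S N P N.+1)//.
    apply: eq_bigr => p _; rewrite -mulr_sumr /T rmorph_sum /=.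
    by congr (_ * _); apply: eq_bigr => nu _; rewrite rmorph_nat.
  move=> n Nn; rewrite divn_small ?/divisor_summatory ?big_geq//.
  by rewrite (leq_trans Nn)// -mulnn leq_pmulr//; case: n Nn.
pose A : R[i] := x%:C * (ln x + (2 * euler_gamma R - 1))%:C.
pose B : R[i] := x%:C * 2.
(* With both prime series truncated at [P] the error is a finite sum, which can be recombined prime
   by prime; the error of the theorem is its limit. *)
pose W P : R[i]^o := gcd_sum f x -
  (A *: (\sum_(0 <= p < P | p \in Q) (F p : R[i]^o)) -
   B *: (\sum_(0 <= p < P | p \in Q) (G p : R[i]^o))).
have W_cvg : W @ \oo --> (gcd_sum f x - (A *: (const_C Q S g : R[i]^o) -
    B *: (limn (fun P => \sum_(0 <= p < P | p \in Q) (G p : R[i]^o)) : R[i]^o)) : R[i]^o).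
  exact: (@cvg_affine_combination R[i] (R[i]^o) _ _ _ _ _ A B F_cvg G_cvg).
have -> : gcd_sum f x - x%:C * (const_C Q S g * (ln x)%:C + const_D Q S g) =
   gcd_sum f x - (A *: (const_C Q S g : R[i]^o) -
    B *: (limn (fun P => \sum_(0 <= p < P | p \in Q) (G p : R[i]^o)) : R[i]^o)).
  set d := limn _.
  have -> : const_D Q S g = (2 * euler_gamma R - 1)%:C * const_C Q S g - 2 * d by [].
  rewrite /A /B [(ln x + _)%:C]rmorphD /GRing.scale /=.
  move: (const_C Q S g) d (gcd_sum f x) => c d X.
  by move: (2 * euler_gamma R - 1)%:C (ln x)%:C x%:C => e l y; ring.
apply: (@norm_cvg_le R W _ N.+1 _ W_cvg) => P NP.
have -> : W P = \sum_(0 <= p < P | p \in Q) g p * (rem p)%:C.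
  rewrite /W (gcdE P NP) /GRing.scale /= !mulr_sumr -!sumrB; apply: eq_bigr => p _.
  rewrite /rem /F /G /A /B !rmorphB !rmorphM /= !rmorphB !rmorphM /= rmorph_nat.
  by ring.
apply: le_trans (ler_cmod_sum _ _ _) _.
rewrite -[leRHS]mulrA.
apply: le_trans (ler_wpM2l (mulr_ge0 K10 C20) (HC3 x P x1 lx1 NP)).
rewrite mulr_sumr; case: P NP => // P _.
(* 0 is not prime, so the sum may start at 1; indices outside [Q] are then filled in with
   nonnegative terms. *)
rewrite big_mkcond big_ltn//= ifF ?add0r; last by apply/negP => /set_mem/hQ.
apply: ler_sum_nat => p _; case: ifP => [/set_mem Qp|_]; last first.
  by rewrite !mulr_ge0// ?powR_ge0// decay_ge0.
have p1 := prime_gt1 (hQ p Qp).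
rewrite cmodM cmod_real mulrACA; apply: ler_pM; rewrite ?cmod_ge0//.
  exact: HK1.
exact: HC2.
Unshelve. all: by end_near. Qed.
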